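(* Let $T_{\mathsf{S}}$ be a substrate theory, $\mathit{Po}$ a finite set of policies, $G$ a query, and $H_0,\ldots,H_{n-1}$ a sequence of non-mechanizable facts with $n\geq 1$ (all notions as in the context). Assume: (C1) there is a finite set $C$ of constants of sort $\mathit{Principal}$ such that $T_{\mathsf{S}}\models \forall x.\,\bigvee_{c\in C} x=c \;\wedge \bigwedge_{c_1\in C,\,c_2\in C\setminus\{c_1\}} c_1\neq c_2$, where $x$ has sort $\mathit{Principal}$; (C2) for every rule in $\mathit{Po}$, every variable occurring in its body but not in its head ranges over the set $C$ of principals; (C3) the class of models of $T_{\mathsf{S}}$ is closed under sub-structures; (C4) $T_{\mathsf{S}}$ is (effectively) locally finite; and assume that satisfiability modulo $T_{\mathsf{S}}$ of ground (quantifier-free) formulae is decidable. Then the instance of the bounded reachability problem with bound $n$, sequence $H_0,\ldots,H_{n-1}$ of non-mechanizable facts, and query $G$ is decidable.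
   Context: Work in many-sorted first-order logic. The substrate theory $T_{\mathsf{S}}$ is a consistent first-order theory with sorts $\mathit{Principal}$, $\mathit{Attribute}$, $\mathit{Infon}$, $\mathit{Speech}$, whose signature contains (among possibly other symbols, e.g. constants and operations building attribute values) function symbols $\mathsf{a2i}:\mathit{Principal}\times\mathit{Attribute}\to\mathit{Infon}$, $\mathsf{s2i}:\mathit{Principal}\times\mathit{Speech}\to\mathit{Infon}$, $\mathsf{said}:\mathit{Infon}\to\mathit{Speech}$, $\mathsf{tdOn}:\mathit{Infon}\to\mathit{Attribute}$, a predicate $\mathsf{prim}$ on $\mathit{Attribute}$, and contains the axiom $\forall x,a.\,\mathsf{tdOn}(x)=a\Rightarrow\neg\mathsf{prim}(a)$. A formula is satisfiable modulo $T_{\mathsf{S}}$ if some model of $T_{\mathsf{S}}$ (expanded to the extra predicates) makes it true. A $\Sigma$-theory $T$ is locally finite if $\Sigma$ is finite and for every finite set of fresh constants $\underline a$ there are finitely many ground terms $t_1,\ldots,t_k$ such that every ground $(\Sigma\cup\underline a)$-term $u$ satisfies $T\models u=t_i$ for some $i$; effectively locally finite if these representatives are computable from $\underline a$ and the appropriate $t_i$ is computable from $u$. A substructure of $\mathcal M$ has domain contained in that of $\mathcal M$ with the symbols interpreted by restriction. Extra predicate symbols (not in the signature of $T_{\mathsf{S}}$): $\mathsf{uknows}\subseteq\mathit{Principal}\times\mathit{Infon}$ (internal knowledge of a principal, from non-mechanizable/human activities), $\mathsf{knows}\subseteq\mathit{Principal}\times\mathit{Infon}$, and $\mathsf{msg}\subseteq\mathit{Principal}\times\mathit{Speech}\times\mathit{Principal}$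 (sender, payload, receiver of messages in the network). Policies: a finite set $\mathit{Po}$ of constraint logic programming rules of the form $A_0(\underline x)\leftarrow A_1(\underline x,\underline y)\wedge\cdots\wedge A_m(\underline x,\underline y)\wedge\xi(\underline x,\underline y)$ where $A_0$ is a $\mathsf{knows}$-atom, the $A_i$ are $\mathsf{knows}$- or $\mathsf{uknows}$-atoms, and $\xi$ is a quantifier-free formula of the signature of $T_{\mathsf{S}}$; $\mathit{Po}$ always contains the rules $\mathsf{knows}(p,x)\leftarrow\mathsf{uknows}(p,x)$, $\mathsf{knows}(q,\mathsf{s2i}(p,s))\leftarrow\mathsf{msg}(p,s,q)$, and $\mathsf{knows}(p,x)\leftarrow\mathsf{knows}(p,\mathsf{s2i}(q,\mathsf{said}(x)))\wedge\mathsf{knows}(p,\mathsf{a2i}(q,\mathsf{tdOn}(x)))$. For a set $F$ of constrained ground facts, $\mathit{lfp}(F\cup\mathit{Po})$ is the least fixpoint of the ground immediate consequence operator of $F\cup\mathit{Po}$; states are such sets of facts. State-change rule $\psi$: $\exists p,x,q.\ \mathsf{knows}(p,x)\wedge\forall y,z,w.\,(\mathsf{msg}'(y,z,w)\Leftrightarrow\mathsf{msg}(y,z,w)\vee(y=p\wedge z=\mathsf{said}(x)\wedge w=q))$ (principal $p$ sends to $q$ a message with payload $\mathsf{said}(x)$ for a piece of knowledge $x$ it knows); $S_1\to_\psi S_2$ holds when $S_2$ is obtained by adding $\mathsf{msg}(p,\mathsf{said}(x),q)\sigma$ for a ground substitution $\sigma$ of $p,x,q$ with $S_1\cup\{\mathsf{knows}(p,x)\sigma\}$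 satisfiable modulo $T_{\mathsf{S}}$. A query $G$ is a conjunction of ground facts (of the form $\mathsf{knows}/\mathsf{uknows}(p,x)\leftarrow\xi(p,x)$). Non-mechanizable facts $H_i$ are constrained ground $\mathsf{uknows}$-facts. Bounded reachability instance (bound $n$, facts $H_0,\ldots,H_{n-1}$, query $G$, initially empty network): decide whether there are transitions such that $\mathcal R_n\cup\{G(\mathsf{knows}_n)\}$ is satisfiable modulo $T_{\mathsf{S}}$, where $\mathcal R_0:=\mathit{lfp}(\{H_0(\mathsf{uknows}_0)\}\cup\mathit{Po}(\mathsf{knows}_0))$, $\mathcal R_i\to_\psi R_{i+1}$, $\mathcal R_{i+1}:=\mathit{lfp}(R_{i+1}\cup\{H_{i+1}(\mathsf{uknows}_{i+1})\}\cup\mathit{Po}(\mathsf{knows}_{i+1}))$, and $\mathsf{msg}_i,\mathsf{uknows}_i,\mathsf{knows}_i$ are fresh renamed copies of $\mathsf{msg},\mathsf{uknows},\mathsf{knows}$ at step $i$ ($\alpha(s_i)$ denotes $\alpha$ with symbol $s$ replaced by $s_i$). *)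

(* Defs.v *)
From HB Require Import structures.
From Stdlib Require List.
From mathcomp Require Import all_boot.

Set Implicit Arguments.
Unset Strict Implicit.
Unset Printing Implicit Defensive.

(** * Computability *)

Inductive data := Leaf | Node of data & data.

Definition fstd d := if d is Node a _ then a else Leaf.
Definition sndd d := if d is Node _ b then b else Leaf.

Fixpoint num n := if n is m.+1 then Node Leaf (num m) else Leaf.

Section TreeRec.
Variables f g : data -> data.
Fixpoint tree_rec (p d : data) : data :=
  match d with
  | Leaf => f p
  | Node a b => g (Node p (Node (Node a b) (Node (tree_rec p a) (tree_rec p b))))
  end.
End TreeRec.

(** The total recursive functions, over binary trees instead of natural
    numbers: basic functions, composition, primitive (structural) recursion with
    a parameter, and minimization over the numerals [num n].  As in the textbook
    definition of general recursive functions, minimization is only applied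
    where the search succeeds on every input: this is part of what [h] is
    required to satisfy.  Several arguments are passed as one tree. *)
Inductive recursive : (data -> data) -> Prop :=
| rec_id : recursive id
| rec_leaf : recursive (fun _ => Leaf)
| rec_fst : recursive fstd
| rec_snd : recursive sndd
| rec_node f g : recursive f -> recursive g ->
    recursive (fun x => Node (f x) (g x))
| rec_comp f g : recursive f -> recursive g -> recursive (fun x => f (g x))
| rec_tree f g : recursive f -> recursive g ->
    recursive (fun x => tree_rec f g (fstd x) (sndd x))
| rec_mu f h : recursive f ->
    (forall x, exists n, [/\ h x = num n,
       f (Node x (num n)) = Leaf
     & forall m, m < n -> f (Node x (num m)) <> Leaf]) ->
    recursive h
| rec_ext f g : f =1 g -> recursive f -> recursive g.

(** [P] is decidable on the inputs [x] in [D]; [code] is the concrete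
    representation of inputs.  Nothing is asked on inputs outside [D]. *)
Definition decidable_on (A : Type) (code : A -> data) (D P : A -> Prop) : Prop :=
  exists F, recursive F /\ forall x, D x -> (F (code x) <> Leaf <-> P x).

Definition code_seq (A : Type) (code : A -> data) (s : seq A) : data :=
  foldr (fun x d => Node (code x) d) Leaf s.

Definition mark (k : nat) (d : data) : data := Node (num k) d.

(** * Many-sorted first-order logic *)

Inductive sort := Principal | Attribute | Infon | Speech.

Definition nat_of_sort s :=
  match s with Principal => 0 | Attribute => 1 | Infon => 2 | Speech => 3 end.
Definition sort_of_nat n :=
  match n with 0 => Principal | 1 => Attribute | 2 => Infon | _ => Speech end.
Lemma nat_of_sortK : cancel nat_of_sort sort_of_nat. Proof. by case. Qed.
HB.instance Definition _ := Equality.copy sort (can_type nat_of_sortK).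

Inductive hlist (D : sort -> Type) : seq sort -> Type :=
| hnil : hlist D [::]
| hcons s l : D s -> hlist D l -> hlist D (s :: l).
Arguments hnil {D}.

Definition hmap D E (f : forall s, D s -> E s) :=
  fix go l (h : hlist D l) : hlist E l :=
    match h in hlist _ l return hlist E l with
    | hnil => hnil
    | hcons s l x h' => hcons (f s x) (go l h')
    end.

Definition hcat D (A : Type) (f : forall s, D s -> seq A) :=
  fix go l (h : hlist D l) : seq A :=
    match h with
    | hnil => [::]
    | hcons s l x h' => f s x ++ go l h'
    end.

Definition hcode D (f : forall s, D s -> data) :=
  fix go l (h : hlist D l) : data :=
    match h with
    | hnil => Leaf
    | hcons s l x h' => Node (f s x) (go l h')
    end.

(** A signature is given by the symbols it has besides [a2i], [s2i], [said],
    [tdOn], [prim].  Signatures are finite, which is part of the definition of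
    local finiteness (see [effectively_locally_finite]). *)
Record signature := Signature {
  xfun : finType;
  xfun_args : xfun -> seq sort;
  xfun_res : xfun -> sort;
  xpred : finType;
  xpred_args : xpred -> seq sort
}.

Section Logic.
Variable Sig : signature.

Inductive fsym := a2i | s2i | said | tdOn | other_fun of xfun Sig.
Inductive psym := prim | other_pred of xpred Sig.

Definition fargs (f : fsym) : seq sort :=
  match f with
  | a2i => [:: Principal; Attribute]
  | s2i => [:: Principal; Speech]
  | said => [:: Infon]
  | tdOn => [:: Infon]
  | other_fun e => xfun_args e
  end.

Definition fres (f : fsym) : sort :=
  match f with
  | a2i => Infon
  | s2i => Infon
  | said => Speech
  | tdOn => Attribute
  | other_fun e => xfun_res e
  end.

Definition pargs (p : psym) : seq sort :=
  match p with prim => [:: Attribute] | other_pred e => xpred_args e end.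

(** Variables [Var s n] also play the part of fresh constants: an
    interpretation of fresh constants in a structure is a valuation. *)
Inductive term : sort -> Type :=
| Var s (n : nat) : term s
| App f : hlist term (fargs f) -> term (fres f).

Inductive qform :=
| QTrue
| QFalse
| QEq s of term s & term s
| QPred p of hlist term (pargs p)
| QNot of qform
| QAnd of qform & qform
| QOr of qform & qform.

Inductive form :=
| FQf of qform
| FNot of form
| FAnd of form & form
| FOr of form & form
| FAll (s : sort) (n : nat) of form
| FEx (s : sort) (n : nat) of form.

Definition QImp φ χ := QOr (QNot φ) χ.
Definition QAll (φs : seq qform) : qform := foldr QAnd QTrue φs.
Definition QSome (φs : seq qform) : qform := foldr QOr QFalse φs.

Definition var : Type := sort * nat.

Fixpoint tvars s (t : term s) : seq var :=
  match t with
  | Var s n => [:: (s, n)]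
  | App f ts => hcat tvars ts
  end.

Fixpoint qvars (φ : qform) : seq var :=
  match φ with
  | QTrue | QFalse => [::]
  | QEq s t u => tvars t ++ tvars u
  | QPred p ts => hcat tvars ts
  | QNot φ => qvars φ
  | QAnd φ χ | QOr φ χ => qvars φ ++ qvars χ
  end.

Definition qground (φ : qform) : Prop := qvars φ = [::].

Definition subst : Type := forall s, nat -> term s.

Fixpoint tsubst (σ : subst) s (t : term s) : term s :=
  match t with
  | Var s n => σ s n
  | App f ts => App (hmap (tsubst σ) ts)
  end.

Fixpoint qsubst (σ : subst) (φ : qform) : qform :=
  match φ with
  | QTrue => QTrue
  | QFalse => QFalse
  | QEq s t u => QEq (tsubst σ t) (tsubst σ u)
  | QPred p ts => QPred (hmap (tsubst σ) ts)
  | QNot φ => QNot (qsubst σ φ)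
  | QAnd φ χ => QAnd (qsubst σ φ) (qsubst σ χ)
  | QOr φ χ => QOr (qsubst σ φ) (qsubst σ χ)
  end.

Record structure := Structure {
  dom : sort -> Type;
  dom_inh : forall s, inhabited (dom s);
  fint : forall f : fsym, hlist dom (fargs f) -> dom (fres f);
  pint : forall p : psym, hlist dom (pargs p) -> Prop
}.

Definition valuation (M : structure) : Type := forall s, nat -> dom M s.

Fixpoint teval (M : structure) (v : valuation M) s (t : term s) : dom M s :=
  match t with
  | Var s n => v s n
  | App f ts => fint (hmap (teval v) ts)
  end.

Fixpoint qtrue (M : structure) (v : valuation M) (φ : qform) : Prop :=
  match φ with
  | QTrue => True
  | QFalse => False
  | QEq s t u => teval v t = teval v u
  | QPred p ts => pint (hmap (teval v) ts)
  | QNot φ => ~ qtrue v φ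
  | QAnd φ χ => qtrue v φ /\ qtrue v χ
  | QOr φ χ => qtrue v φ \/ qtrue v χ
  end.

Definition agree_except M (s : sort) (n : nat) (v w : valuation M) : Prop :=
  forall s' m, (s', m) <> (s, n) -> w s' m = v s' m.

Fixpoint ftrue (M : structure) (v : valuation M) (φ : form) : Prop :=
  match φ with
  | FQf φ => qtrue v φ
  | FNot φ => ~ ftrue v φ
  | FAnd φ χ => ftrue v φ /\ ftrue v χ
  | FOr φ χ => ftrue v φ \/ ftrue v χ
  | FAll s n φ => forall w, agree_except s n v w -> ftrue w φ
  | FEx s n φ => exists w, agree_except s n v w /\ ftrue w φ
  end.

(** A formula with free variables stands for its universal closure, both as an
    axiom and as a consequence. *)
Definition valid (M : structure) (φ : form) : Prop :=
  forall v : valuation M, ftrue v φ.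

Definition theory : Type := form -> Prop.

Definition model (T : theory) (M : structure) : Prop :=
  forall φ, T φ -> valid M φ.

Definition entails (T : theory) (φ : form) : Prop :=
  forall M, model T M -> valid M φ.

Definition consistent (T : theory) : Prop := exists M, model T M.

Definition ap1 s r (f : hlist term [:: s] -> term r) t := f (hcons t hnil).
Definition ap2 s1 s2 r (f : hlist term [:: s1; s2] -> term r) t u :=
  f (hcons t (hcons u hnil)).

Definition t_a2i := ap2 (@App a2i : hlist term [:: Principal; Attribute] -> term Infon).
Definition t_s2i := ap2 (@App s2i : hlist term [:: Principal; Speech] -> term Infon).
Definition t_said := ap1 (@App said : hlist term [:: Infon] -> term Speech).
Definition t_tdOn := ap1 (@App tdOn : hlist term [:: Infon] -> term Attribute).
Definition q_prim (a : term Attribute) : qform := @QPred prim (hcons a hnil).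

Definition tdOn_not_prim : form :=
  FAll Infon 0 (FAll Attribute 0
    (FQf (QImp (QEq (t_tdOn (Var Infon 0)) (Var Attribute 0))
               (QNot (q_prim (Var Attribute 0)))))).

Definition substrate_theory (T : theory) : Prop :=
  consistent T /\ entails T tdOn_not_prim.

Definition is_const s (t : term s) : bool :=
  if t is App f _ then nilp (fargs f) else false.

Fixpoint distinct s (C : seq (term s)) : qform :=
  if C is c :: C' then QAnd (QAll [seq QNot (QEq c d) | d <- C']) (distinct C')
  else QTrue.

(** The finite set [C] is given by a list; [distinct] ranges over pairs of
    positions, so it also says that the list has no duplicates. *)
Definition finite_principals (T : theory) (C : seq (term Principal)) : Prop :=
  (forall c, List.In c C -> is_const c) /\
  entails T (FAll Principal 0 (FQf
    (QAnd (QSome [seq QEq (Var Principal 0) c | c <- C]) (distinct C)))).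

(** [N] is a substructure of [M]; the inclusion of domains is an injection. *)
Definition substructure (N M : structure) : Prop :=
  exists e : forall s, dom N s -> dom M s,
    [/\ forall s, injective (@e s),
        forall f (a : hlist (dom N) (fargs f)), e _ (fint a) = fint (hmap e a)
      & forall p (a : hlist (dom N) (pargs p)), pint a <-> pint (hmap e a)].

Definition closed_under_substructures (T : theory) : Prop :=
  forall M N, model T M -> substructure N M -> model T N.

(** ** Concrete representation of syntax *)

Definition code_fsym (f : fsym) : data :=
  num match f with
      | a2i => 0 | s2i => 1 | said => 2 | tdOn => 3
      | other_fun e => 4 + enum_rank e
      end.

Definition code_psym (p : psym) : data :=
  num match p with prim => 0 | other_pred e => 1 + enum_rank e end.

Definition code_var (x : var) : data := Node (num (nat_of_sort x.1)) (num x.2).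

Fixpoint code_term s (t : term s) : data :=
  match t with
  | Var s n => mark 0 (code_var (s, n))
  | App f ts => mark 1 (Node (code_fsym f) (hcode code_term ts))
  end.

Fixpoint code_qform (φ : qform) : data :=
  match φ with
  | QTrue => mark 0 Leaf
  | QFalse => mark 1 Leaf
  | QEq s t u =>
      mark 2 (Node (num (nat_of_sort s)) (Node (code_term t) (code_term u)))
  | QPred p ts => mark 3 (Node (code_psym p) (hcode code_term ts))
  | QNot φ => mark 4 (code_qform φ)
  | QAnd φ χ => mark 5 (Node (code_qform φ) (code_qform χ))
  | QOr φ χ => mark 6 (Node (code_qform φ) (code_qform χ))
  end.

Definition sterm : Type := {s : sort & term s}.
Definition code_sterm (t : sterm) : data :=
  Node (num (nat_of_sort (tag t))) (code_term (tagged t)).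

(** ** Effective local finiteness and decidability of ground satisfiability *)

Definition term_over (a : seq var) (t : sterm) : Prop :=
  {subset tvars (tagged t) <= a}.

(** [a] is the finite set of fresh constants. *)
Definition effectively_locally_finite (T : theory) : Prop :=
  exists (reps : seq var -> seq sterm) (R N : data -> data),
    [/\ recursive R, recursive N,
        forall a, R (code_seq code_var a) = code_seq code_sterm (reps a),
        forall a t, List.In t (reps a) -> term_over a t
      & forall a s (u : term s), term_over a (Tagged term u) ->
          exists t : term s,
            [/\ List.In (Tagged term t) (reps a),
                entails T (FQf (QEq u t))
              & N (Node (code_seq code_var a) (code_sterm (Tagged term u))) =
                code_sterm (Tagged term t)]].

Definition satisfiable (T : theory) (φ : qform) : Prop :=
  exists M (v : valuation M), model T M /\ qtrue v φ.

Definition ground_satisfiability_decidable (T : theory) : Prop :=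
  decidable_on code_qform qground (satisfiable T).

(** * Policies and states *)

Inductive atom :=
| Knows of term Principal & term Infon
| Uknows of term Principal & term Infon
| Msg of term Principal & term Speech & term Principal.

Definition avars (A : atom) : seq var :=
  match A with
  | Knows p x | Uknows p x => tvars p ++ tvars x
  | Msg p s q => tvars p ++ tvars s ++ tvars q
  end.

Definition asubst (σ : subst) (A : atom) : atom :=
  match A with
  | Knows p x => Knows (tsubst σ p) (tsubst σ x)
  | Uknows p x => Uknows (tsubst σ p) (tsubst σ x)
  | Msg p s q => Msg (tsubst σ p) (tsubst σ s) (tsubst σ q)
  end.

Definition is_knows A := if A is Knows _ _ then true else false.
Definition is_uknows A := if A is Uknows _ _ then true else false.
Definition is_msg A := if A is Msg _ _ _ then true else false.

Record rule := Rule { rhead : atom; rbody : seq atom; rconstr : qform }.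

Record fact := Fact { fatom : atom; fconstr : qform }.

Definition fact_rule (f : fact) : rule := Rule (fatom f) [::] (fconstr f).

Definition body_vars (r : rule) : seq var :=
  flatten (map avars (rbody r)) ++ qvars (rconstr r).

Definition ground_fact (f : fact) : Prop :=
  avars (fatom f) = [::] /\ qvars (fconstr f) = [::].

Definition rule_subst (σ : subst) (r : rule) : rule :=
  Rule (asubst σ (rhead r)) (map (asubst σ) (rbody r)) (qsubst σ (rconstr r)).

Definition ground_rule (r : rule) : Prop :=
  avars (rhead r) = [::] /\ body_vars r = [::].

Definition uknows_rule : rule :=
  let p := Var Principal 0 in let x := Var Infon 0 in
  Rule (Knows p x) [:: Uknows p x] QTrue.

Definition msg_rule : rule :=
  let p := Var Principal 0 in let s := Var Speech 0 in let q := Var Principal 1 in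
  Rule (Knows q (t_s2i p s)) [:: Msg p s q] QTrue.

Definition trust_rule : rule :=
  let p := Var Principal 0 in let q := Var Principal 1 in let x := Var Infon 0 in
  Rule (Knows p x)
    [:: Knows p (t_s2i q (t_said x)); Knows p (t_a2i q (t_tdOn x))] QTrue.

(** Only the mandatory rule [msg_rule] has a [Msg] atom in its body. *)
Definition policies (Po : seq rule) : Prop :=
  (forall r, List.In r [:: uknows_rule; msg_rule; trust_rule] -> List.In r Po) /\
  (forall r, List.In r Po -> r = msg_rule \/
     is_knows (rhead r) /\ all (fun A => is_knows A || is_uknows A) (rbody r)).

(** When the theory satisfies [finite_principals T C], ranging over the set [C]
    is the same as being of sort [Principal]. *)
Definition local_vars_principals (Po : seq rule) : Prop :=
  forall r, List.In r Po ->
    forall x : var, x \in body_vars r -> x \notin avars (rhead r) -> x.1 = Principal.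

Definition query (G : seq fact) : Prop :=
  forall g, List.In g G ->
    ground_fact g /\ (is_knows (fatom g) || is_uknows (fatom g)).

Definition non_mechanizable (h : fact) : Prop :=
  ground_fact h /\ is_uknows (fatom h).

(** The renamed copy of a rule or of a fact at step [k], that is, with [knows],
    [uknows], [msg] replaced with [knows_k], [uknows_k], [msg_k], is its
    pairing with [k]: [S k f] says that the copy of [f] at step [k] is in [S]. *)
Definition rules : Type := nat -> rule -> Prop.
Definition state : Type := nat -> fact -> Prop.

Definition atom_eq (A B : atom) : qform :=
  match A, B with
  | Knows p x, Knows p' x' => QAnd (QEq p p') (QEq x x')
  | Uknows p x, Uknows p' x' => QAnd (QEq p p') (QEq x x')
  | Msg p s q, Msg p' s' q' => QAnd (QEq p p') (QAnd (QEq s s') (QEq q q'))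
  | _, _ => QFalse
  end.

(** Resolving the ground instance [A0 <- A1, ..., Am, xi] of a rule with facts
    [Bi <- zi] gives [A0 <- xi, z1, A1 = B1, ..., zm, Am = Bm]: ground atoms
    are matched up to equality in the theory, through the constraint. *)
Definition resolve (r : rule) (fs : seq fact) : fact :=
  Fact (rhead r)
    (QAnd (rconstr r)
       (QAll [seq QAnd (fconstr Af.2) (atom_eq Af.1 (fatom Af.2))
             | Af <- zip (rbody r) fs])).

(** The ground immediate consequence operator.  Only the instance is asked to
    be ground, since some sorts may have no ground term. *)
Definition immediate (P : rules) (S : state) : state := fun k f =>
  exists r (σ : subst) fs,
    [/\ P k r, ground_rule (rule_subst σ r),
        size fs = size (rbody r) /\ (forall g, List.In g fs -> S k g)
      & f = resolve (rule_subst σ r) fs].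

(** Least fixpoint, as the intersection of all pre-fixpoints. *)
Definition lfp (P : rules) : state := fun k f =>
  forall S : state, (forall j g, immediate P S j g -> S j g) -> S k f.

(** ** Truth in expanded structures *)

Record expansion (M : structure) := Expansion {
  knows_int : nat -> dom M Principal -> dom M Infon -> Prop;
  uknows_int : nat -> dom M Principal -> dom M Infon -> Prop;
  msg_int : nat -> dom M Principal -> dom M Speech -> dom M Principal -> Prop
}.

Definition atom_true M (E : expansion M) (v : valuation M) (k : nat) (A : atom) : Prop :=
  match A with
  | Knows p x => knows_int E k (teval v p) (teval v x)
  | Uknows p x => uknows_int E k (teval v p) (teval v x)
  | Msg p s q => msg_int E k (teval v p) (teval v s) (teval v q)
  end.

Definition fact_true M (E : expansion M) (k : nat) (f : fact) : Prop :=
  forall v : valuation M, qtrue v (fconstr f) -> atom_true E v k (fatom f).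

Definition expansion_le M (E E' : expansion M) : Prop :=
  [/\ forall k p x, knows_int E k p x -> knows_int E' k p x,
      forall k p x, uknows_int E k p x -> uknows_int E' k p x
    & forall k p s q, msg_int E k p s q -> msg_int E' k p s q].

Definition state_true M (E : expansion M) (S : state) : Prop :=
  forall k f, S k f -> fact_true E k f.

(** A state determines the extra predicates: they hold where a fact of the
    state makes them hold, and nowhere else. *)
Definition least_expansion M (S : state) (E : expansion M) : Prop :=
  state_true E S /\ forall E', state_true E' S -> expansion_le E E'.

(** [S] together with the copies at step [k] of the facts in [G] is satisfiable
    modulo [T]. *)
Definition state_satisfiable (T : theory) (S : state) (k : nat) (G : seq fact) : Prop :=
  exists (M : structure) (E : expansion M),
    [/\ model T M, least_expansion S E
      & forall g, List.In g G -> fact_true E k g].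

(** ** Bounded reachability *)

(** The frame part of the state-change rule makes the messages of step [k]
    messages of step [k.+1]. *)
Definition send (S : state) (k : nat) (p : term Principal) (x : term Infon)
    (q : term Principal) : state := fun j f =>
  S j f \/
  j = k.+1 /\ (is_msg (fatom f) /\ S k f \/ f = Fact (Msg p (t_said x) q) QTrue).

Inductive step (T : theory) (k : nat) (S1 : state) : state -> Prop :=
| Step p x q :
    tvars p = [::] -> tvars x = [::] -> tvars q = [::] ->
    state_satisfiable T S1 k [:: Fact (Knows p x) QTrue] ->
    step T k S1 (send S1 k p x q).

(** There is no fact [H_n]: nothing is added for [k >= size H]. *)
Definition program (S : state) (H : seq fact) (Po : seq rule) (k : nat) : rules :=
  fun j r =>
    [\/ exists f, S j f /\ r = fact_rule f,
        j = k /\ exists h, onth H k = Some h /\ r = fact_rule h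
      | j = k /\ List.In r Po].

Definition empty_state : state := fun _ _ => False.

Inductive run (T : theory) (Po : seq rule) (H : seq fact) : nat -> state -> Prop :=
| Run0 : run T Po H 0 (lfp (program empty_state H Po 0))
| RunS k S S' : run T Po H k S -> step T k S S' ->
    run T Po H k.+1 (lfp (program S' H Po k.+1)).

(** The bound is [size nmfacts]. *)
Record instance := Instance {
  pol : seq rule;
  nmfacts : seq fact;
  goal : seq fact
}.

Definition well_formed (I : instance) : Prop :=
  [/\ policies (pol I), 0 < size (nmfacts I),
      forall h, List.In h (nmfacts I) -> non_mechanizable h
    & query (goal I)].

Definition bounded_reachability (T : theory) (I : instance) : Prop :=
  let n := size (nmfacts I) in
  exists R, run T (pol I) (nmfacts I) n R /\ state_satisfiable T R n (goal I).

Definition code_atom (A : atom) : data :=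
  match A with
  | Knows p x => mark 0 (Node (code_term p) (code_term x))
  | Uknows p x => mark 1 (Node (code_term p) (code_term x))
  | Msg p s q => mark 2 (Node (code_term p) (Node (code_term s) (code_term q)))
  end.

Definition code_fact (f : fact) : data :=
  Node (code_atom (fatom f)) (code_qform (fconstr f)).

Definition code_rule (r : rule) : data :=
  Node (code_atom (rhead r))
    (Node (code_seq code_atom (rbody r)) (code_qform (rconstr r))).

Definition code_instance (I : instance) : data :=
  Node (code_seq code_rule (pol I))
    (Node (code_seq code_fact (nmfacts I)) (code_seq code_fact (goal I))).

End Logic.

(* Main.v *)
From HB Require Import structures.
From Stdlib Require List.
From mathcomp Require Import all_boot boolp.
Require Import Defs.

(** Only ground instances of the rules enter the least fixpoints, and by local
    finiteness every ground term equals, modulo the theory, one of finitely many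
    representatives.  So up to equality there are finitely many ground atoms,
    finitely many "worlds" (truth assignments to ground atomic formulas induced
    by models), and finitely many Horn clauses "head, set of body atoms, set of
    worlds where the constraint holds".  A policy set, a fact and a query thus
    act only through a set of such clauses, an element of a finite type.  The
    sets of messages that can have been sent after [k] steps are the states of a
    finite automaton reading the facts [H_0], ..., [H_(n-1)].  Everything that
    depends on the theory only (the equality table of the representatives, which
    worlds come from models, which transitions are possible) is a finite table,
    hence recursive whatever it is.  The only unbounded computation is the
    translation of a rule into clauses, which runs through all assignments of
    representatives to the variables of the rule. *)

Set Implicit Arguments.
Unset Strict Implicit.
Unset Printing Implicit Defensive.

(** * Closure properties of the recursive functions on trees *)

(** Reads any tree as a number, inverting [num]. *)
Fixpoint spine (d : data) : nat := if d is Node _ b then (spine b).+1 else 0.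

Fixpoint tsize (d : data) : nat := if d is Node a b then (tsize a + tsize b).+1 else 0.

Lemma spine_num n : spine (num n) = n.
Proof. by elim: n => //= n ->. Qed.

Lemma spine_tsize d : spine d <= tsize d.
Proof. by elim: d => //= a _ b IH; rewrite ltnS (leq_trans IH) ?leq_addl. Qed.

Lemma rec_const c : recursive (fun _ => c).
Proof. by elim: c => [|a Ha b Hb]; [exact: rec_leaf | exact: rec_node]. Qed.

Lemma rec_tree_at f g p c : recursive f -> recursive g -> recursive p ->
  recursive c -> recursive (fun d => tree_rec f g (p d) (c d)).
Proof.
move=> Hf Hg Hp Hc.
exact: (rec_comp (rec_tree Hf Hg) (rec_node Hp Hc)).
Qed.

(** Branching is a tree recursion whose node case discards the recursive values and finds the
    original input in the parameter. *)
Lemma rec_if_leaf c h k : recursive c -> recursive h -> recursive k ->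
  recursive (fun d => if c d is Node _ _ then k d else h d).
Proof.
move=> Hc Hh Hk.
apply: (@rec_ext (fun d => tree_rec h (fun z => k (fstd z)) d (c d))).
  by move=> d; case: (c d).
by apply: rec_tree_at => //; [apply: rec_comp => //; exact: rec_fst | exact: rec_id].
Qed.

(** A finite table of functions is iterated branching: each entry passed strips one [Node] from the
    selector. *)
Lemma rec_nth_spine h0 hs c : recursive h0 -> (forall i, recursive (nth h0 hs i)) ->
  recursive c -> recursive (fun d => nth h0 hs (spine (c d)) d).
Proof.
move=> Hh0; elim: hs c => [|h hs IH] c Hhs Hc.
  by apply: (rec_ext _ Hh0) => d; rewrite nth_nil.
apply: (@rec_ext (fun d => if c d is Node _ _ then nth h0 hs (spine (sndd (c d))) d
                           else h d)).
  by move=> d; case: (c d).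
apply: rec_if_leaf => //; first exact: (Hhs 0).
apply: (IH (fun d => sndd (c d))); last exact: (rec_comp rec_snd Hc).
by move=> i; apply: (Hhs i.+1).
Qed.

(** * Recursive functions with values in a finite type *)

Definition code_fin (X : finType) (x : X) : data := num (enum_rank x).

Definition decode_fin (X : finType) (x0 : X) (d : data) : X := nth x0 (enum X) (spine d).

Lemma code_finK (X : finType) (x0 : X) : cancel (@code_fin X) (decode_fin x0).
Proof. by move=> x; rewrite /decode_fin spine_num nth_enum_rank. Qed.

Definition finrec (X : finType) (f : data -> X) : Prop :=
  recursive (fun d => code_fin (f d)).

(** [h] need not be uniform in its first argument: [X] being finite, the functions [h x] are listed
    in a hard-wired table. *)
Lemma rec_fin_case (X : finType) (f : data -> X) (h : X -> data -> data) :
  finrec f -> (forall x, recursive (h x)) -> recursive (fun d => h (f d) d).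
Proof.
move=> Hf Hh.
apply: (@rec_ext (fun d => nth id [seq h x | x <- enum X] (spine (code_fin (f d))) d)).
  move=> d; rewrite spine_num (nth_map (f d)) ?nth_enum_rank //.
  by rewrite -cardE ltn_ord.
apply: (rec_nth_spine (h0 := id) (c := fun d => code_fin (f d))) => //; first exact: rec_id.
move=> i; case: (ltnP i (size (enum X))) => Hi.
  case E: (enum X) Hi => [//|x0 s] Hi; rewrite (nth_map x0) //; exact: Hh.
by rewrite nth_default ?(size_map _ (enum X)) //; exact: rec_id.
Qed.

Lemma finrec_bind (X Y : finType) (f : data -> X) (h : X -> data -> Y) :
  finrec f -> (forall x, finrec (h x)) -> finrec (fun d => h (f d) d).
Proof. exact: (@rec_fin_case X f (fun x d => code_fin (h x d))). Qed.

Lemma finrec_ext (X : finType) (f g : data -> X) : f =1 g -> finrec f -> finrec g.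
Proof. by move=> E; apply: rec_ext => d; rewrite E. Qed.

Lemma finrec_const (X : finType) (x : X) : finrec (fun _ => x).
Proof. exact: rec_const. Qed.

Lemma finrec_comp (X : finType) (f : data -> X) g :
  finrec f -> recursive g -> finrec (fun d => f (g d)).
Proof. exact: rec_comp. Qed.

(** Here [h] is an arbitrary map, possibly defined by a classical choice. This makes every finite
    table that depends on the theory alone recursive. *)
Lemma finrec_map (X Y : finType) (h : X -> Y) (f : data -> X) :
  finrec f -> finrec (fun d => h (f d)).
Proof. by move=> Hf; apply: (finrec_bind (h := fun x _ => h x) Hf) => x; apply: finrec_const. Qed.

Lemma finrec_map2 (X Y Z : finType) (h : X -> Y -> Z) (f : data -> X) (g : data -> Y) :
  finrec f -> finrec g -> finrec (fun d => h (f d) (g d)).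
Proof.
move=> Hf Hg; apply: (finrec_bind (h := fun x d => h x (g d)) Hf) => x.
exact: finrec_map.
Qed.

Lemma finrec_decode (X : finType) (x0 : X) : finrec (decode_fin x0).
Proof.
apply: (@rec_ext (fun d =>
  nth (fun _ => code_fin x0) [seq (fun _ => code_fin x) | x <- enum X] (spine d) d)).
  move=> d; rewrite /decode_fin; case: (ltnP (spine d) (size (enum X))) => Hi.
    by rewrite (nth_map x0).
  by rewrite !nth_default ?(size_map _ (enum X)).
apply: (rec_nth_spine (c := id)); [exact: rec_const| |exact: rec_id].
move=> i; case: (ltnP i (size (enum X))) => Hi.
  by rewrite (nth_map x0) //; exact: rec_const.
by rewrite nth_default ?(size_map _ (enum X)) //; exact: rec_const.
Qed.

Definition capped (k : nat) (d : data) : 'I_k.+1 := inord (minn (spine d) k).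

Lemma cappedE k d : capped k d = minn (spine d) k :> nat.
Proof. by rewrite inordK // ltnS geq_minr. Qed.

Lemma capped_num k n : n <= k -> capped k (num n) = n :> nat.
Proof. by move=> H; rewrite cappedE spine_num; apply/minn_idPl. Qed.

Lemma finrec_capped k : finrec (capped k).
Proof.
apply: finrec_ext (finrec_decode (@ord_max k)) => d.
apply: val_inj; rewrite /= cappedE /decode_fin.
case: (ltnP (spine d) k.+1) => Hi.
  by rewrite nth_enum_ord //; apply/esym/minn_idPl.
by rewrite nth_default ?size_enum_ord //=; apply/esym/minn_idPr/ltnW.
Qed.

Fixpoint tfold (X : Type) (x0 : X) (step : data -> data -> X -> X -> X) (d : data) : X :=
  if d is Node a b then step a b (tfold x0 step a) (tfold x0 step b) else x0.

(** The accumulator is carried as a code. Decoding both recursive values and branching on the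
    finitely many possibilities leaves a step that is recursive by assumption. *)
Lemma finrec_tfold (X : finType) (x0 : X) (step : data -> data -> data -> X -> X -> X) p c :
  (forall x y, finrec (fun z => step (fstd z) (fstd (sndd z)) (sndd (sndd z)) x y)) ->
  recursive p -> recursive c -> finrec (fun d => tfold x0 (step (p d)) (c d)).
Proof.
move=> Hs Hp Hc.
pose g z := code_fin (step (fstd z) (fstd (fstd (sndd z))) (sndd (fstd (sndd z)))
  (decode_fin x0 (fstd (sndd (sndd z)))) (decode_fin x0 (sndd (sndd (sndd z))))).
apply: (@rec_ext (fun d => tree_rec (fun _ => code_fin x0) g (p d) (c d))).
  move=> d; elim: (c d) => //= a -> b ->.
  by rewrite /g /= !code_finK.
apply: rec_tree_at => //; first exact: rec_const.
have r1 : recursive (fun z => fstd (fstd (sndd z))).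
  exact: (rec_comp rec_fst (rec_comp rec_fst rec_snd)).
have r2 : recursive (fun z => sndd (fstd (sndd z))).
  exact: (rec_comp rec_snd (rec_comp rec_fst rec_snd)).
have r3 : finrec (fun z => decode_fin x0 (fstd (sndd (sndd z)))).
  exact: (finrec_comp (finrec_decode x0) (rec_comp rec_fst (rec_comp rec_snd rec_snd))).
have r4 : finrec (fun z => decode_fin x0 (sndd (sndd (sndd z)))).
  exact: (finrec_comp (finrec_decode x0) (rec_comp rec_snd (rec_comp rec_snd rec_snd))).
apply: (finrec_bind (h := fun x z => step (fstd z) (fstd (fstd (sndd z)))
  (sndd (fstd (sndd z))) x (decode_fin x0 (sndd (sndd (sndd z))))) r3) => x.
apply: (finrec_bind (h := fun y z => step (fstd z) (fstd (fstd (sndd z)))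
  (sndd (fstd (sndd z))) x y) r4) => y.
exact: (finrec_comp (Hs x y) (rec_node rec_fst (rec_node r1 r2))).
Qed.

(** * Recursive enumeration of assignments of bounded length *)

Fixpoint dmem (x d : data) : Prop := if d is Node a b then x = a \/ dmem x b else False.

Definition cons_all (e l r : data) : data :=
  tree_rec id (fun z => Node (Node e (fstd (fstd (sndd z)))) (sndd (sndd (sndd z)))) r l.

Lemma dmem_cons_all e l r x : dmem x (cons_all e l r) <->
  (exists2 y, dmem y l & x = Node e y) \/ dmem x r.
Proof.
rewrite /cons_all; elim: l => [|a _ l IH] /=.
  by split; [right | case=> // -[]].
rewrite IH; split.
- case=> [->|[[y Hy ->]|H]]; [left | left | by right].
    by exists a => //; left.
  by exists y => //; right.
- case=> [[y [->|Hy] ->]|H]; [by left | right; left | by right; right].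
  by exists y.
Qed.

Definition extend (X : finType) (l : data) : data :=
  foldr (fun e r => cons_all (code_fin e) l r) Leaf (enum X).

Lemma dmem_extend (X : finType) (e : X) l y : dmem y l -> dmem (Node (code_fin e) y) (extend X l).
Proof.
move=> Hy; rewrite /extend; have: e \in enum X by rewrite mem_enum.
elim: (enum X) => //= e' s IH; rewrite inE dmem_cons_all => /orP[/eqP<-|/IH]; last by right.
by left; exists y.
Qed.

Lemma rec_extend (X : finType) : recursive (@extend X).
Proof.
rewrite /extend; elim: (enum X) => [|e s IH] /=; first exact: rec_const.
apply: rec_tree_at => //; [exact: rec_id| |exact: rec_id].
have r1 : recursive (fun z => fstd (fstd (sndd z))).
  exact: (rec_comp rec_fst (rec_comp rec_fst rec_snd)).
have r2 : recursive (fun z => sndd (sndd (sndd z))).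
  exact: (rec_comp rec_snd (rec_comp rec_snd rec_snd)).
exact: (rec_node (rec_node (rec_const _) r1) r2).
Qed.

(** The inner recursion is unary addition: it stacks the size of the left subtree onto that of the
    right one. *)
Definition unary_size (d : data) : data :=
  tree_rec (fun _ => Leaf)
    (fun z => Node Leaf
      (tree_rec id (fun y => Node Leaf (sndd (sndd (sndd y))))
         (sndd (sndd (sndd z))) (fstd (sndd (sndd z))))) Leaf d.

Lemma unary_sizeE d : unary_size d = num (tsize d).
Proof.
rewrite /unary_size; elim: d => //= a -> b ->; congr (Node _ _).
by elim: (tsize a) => //= n ->.
Qed.

Lemma rec_unary_size : recursive unary_size.
Proof.
apply: rec_tree_at; [exact: rec_const| |exact: rec_const|exact: rec_id].
apply: (rec_node (rec_const _)); apply: rec_tree_at; first exact: rec_id.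
- exact: (rec_node (rec_const _) (rec_comp rec_snd (rec_comp rec_snd rec_snd))).
- exact: (rec_comp rec_snd (rec_comp rec_snd rec_snd)).
- exact: (rec_comp rec_fst (rec_comp rec_snd rec_snd)).
Qed.

(** All codes of lists over [X] of length [tsize d], a bound on the variable
    indices that occur in [d]. *)
Definition all_lists (X : finType) (d : data) : data :=
  tree_rec (fun _ => Node Leaf Leaf) (fun z => extend X (sndd (sndd (sndd z)))) Leaf
    (unary_size d).

Lemma rec_all_lists (X : finType) : recursive (@all_lists X).
Proof.
apply: rec_tree_at; [exact: rec_const| |exact: rec_const|exact: rec_unary_size].
exact: (rec_comp (@rec_extend X) (rec_comp rec_snd (rec_comp rec_snd rec_snd))).
Qed.

Definition dnth (d : data) (n : nat) : data := fstd (iter n sndd d).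

(** The induction shifts [e] by one: its first value is put in front of the list obtained for the
    rest. *)
Lemma all_listsP (X : finType) (e : nat -> X) d :
  exists2 l, dmem l (all_lists X d) & forall n, n < tsize d -> dnth l n = code_fin (e n).
Proof.
rewrite /all_lists unary_sizeE; elim: (tsize d) e => [|m IH] e /=.
  by exists Leaf => //; left.
have [l Hl El] := IH (fun n => e n.+1).
exists (Node (code_fin (e 0)) l); first exact: dmem_extend.
by case=> [|n] // Hn; rewrite /dnth iterSr; apply: El.
Qed.

Lemma rec_dnth c d : recursive c -> recursive d -> recursive (fun z => dnth (c z) (spine (d z))).
Proof.
move=> Hc Hd.
apply: (@rec_ext (fun z => fstd (tree_rec id (fun y => sndd (sndd (sndd (sndd y)))) (c z) (d z)))).
  move=> z; rewrite /dnth; congr fstd; by elim: (d z) => //= a _ b ->.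
apply: (rec_comp rec_fst); apply: rec_tree_at => //; first exact: rec_id.
exact: (rec_comp rec_snd (rec_comp rec_snd (rec_comp rec_snd rec_snd))).
Qed.

(** * Ground expressions *)

(** Tagging each element with its sort puts argument lists of all arities in one type, where they
    can be compared without dependent equalities. *)
Definition hseq D l (h : hlist D l) : seq {s : sort & D s} :=
  hcat (fun s (x : D s) => [:: Tagged D x]) h.

Lemma hlist_consP D s l (h : hlist D (s :: l)) : exists x h', h = hcons x h'.
Proof.
refine (match h in hlist _ m return
  (if m is s :: l then fun h : hlist D (s :: l) => exists x h', h = hcons x h'
   else fun _ => True) h with hnil => I | hcons s l x h' => _ end).
by exists x, h'.
Qed.

Lemma hlist_nilP D (h : hlist D [::]) : h = hnil.
Proof.
refine (match h in hlist _ m return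
  (if m is [::] then fun h : hlist D [::] => h = hnil else fun _ => True) h
  with hnil => erefl | hcons s l x h' => I end).
Qed.

Lemma Tagged_inj (D : sort -> Type) s : injective (Tagged D : D s -> _).
Proof. by move=> x y; apply: eq_from_Tagged. Qed.

Lemma hseq_inj D l : injective (@hseq D l).
Proof.
elim: l => [|s l IH] h h'; first by rewrite (hlist_nilP h) (hlist_nilP h').
have [x [g ->]] := hlist_consP h; have [x' [g' ->]] := hlist_consP h'.
by rewrite /hseq /= => -[E1 E2]; rewrite (@Tagged_inj D s x x' E1) (IH _ _ E2).
Qed.

(** Terms nest inside [hlist], so induction has to treat terms and argument lists together. *)
Section TermInduction.
Variable Sig : signature.
Variables (P : forall s, term Sig s -> Prop) (Q : forall l, hlist (term Sig) l -> Prop).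
Hypothesis Pvar : forall s n, P (Var Sig s n).
Hypothesis Papp : forall f ts, Q ts -> P (@App Sig f ts).
Hypothesis Qnil : Q hnil.
Hypothesis Qcons : forall s l (t : term Sig s) (ts : hlist _ l),
  P t -> Q ts -> Q (hcons t ts).

Fixpoint term_nested_ind s (t : term Sig s) : P t :=
  match t with
  | Var s n => Pvar s n
  | App f ts => Papp
      ((fix go l (h : hlist _ l) : Q h :=
          match h with
          | hnil => Qnil
          | hcons _ _ t h' => Qcons (term_nested_ind t) (go _ h')
          end) _ ts)
  end.

Lemma term_hlist_ind : (forall s t, @P s t) /\ (forall l h, @Q l h).
Proof.
split=> [|l h]; first exact: term_nested_ind.
elim: h => [|s l' t h IH]; first exact: Qnil.
by apply: Qcons => //; apply: term_nested_ind.
Qed.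
End TermInduction.

(** [o] is defined exactly when [vs], the variables left in some expression, is
    empty, and its value then satisfies [P]. *)
Definition ospec (X A : Type) (o : option X) (vs : seq A) (P : X -> Prop) : Prop :=
  if o is Some x then vs = [::] /\ P x else vs <> [::].

Definition omap2 (X Y Z : Type) (f : X -> Y -> Z) (o : option X) (o' : option Y) :=
  if o is Some x then omap (f x) o' else None.

(** A concatenation is empty exactly when both parts are: groundness is checked compositionally. *)
Lemma ospec_map2 (X Y Z A : Type) (f : X -> Y -> Z) o o' (vs vs' : seq A) P P' (Q : Z -> Prop) :
  ospec o vs P -> ospec o' vs' P' -> (forall x y, P x -> P' y -> Q (f x y)) ->
  ospec (omap2 f o o') (vs ++ vs') Q.
Proof.
case: o => [x|] /=; last by case: vs.
case: o' => [y|] /= [-> Px]; last by [].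
by case=> -> P'y H; split=> //; apply: H.
Qed.

Lemma ospec_map (X Y A : Type) (f : X -> Y) o (vs : seq A) P (Q : Y -> Prop) :
  ospec o vs P -> (forall x, P x -> Q (f x)) -> ospec (omap f o) vs Q.
Proof. by case: o => //= x [-> Px] H; split=> //; apply: H. Qed.

Definition seqopt (X : Type) (s : seq (option X)) : option (seq X) :=
  foldr (omap2 cons) (Some [::]) s.

(** * Ground expressions do not depend on valuations or substitutions *)

Section Substitution.
Variable Sig : signature.
Local Notation term := (term Sig).

Lemma teval_ground M (v w : valuation M) :
  (forall s (t : term s), tvars t = [::] -> teval v t = teval w t) /\
  (forall l (h : hlist term l), hcat (@tvars Sig) h = [::] ->
     hmap (teval v) h = hmap (teval w) h).
Proof.
apply: term_hlist_ind => //=; first by move=> f ts IH /IH->.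
move=> s l t ts IH1 IH2 E.
have: nilp (tvars t ++ hcat (@tvars Sig) ts) by rewrite E.
by rewrite cat_nilp => /andP[/nilP/IH1-> /nilP/IH2->].
Qed.

Lemma cat_nil (A : Type) (s1 s2 : seq A) : s1 ++ s2 = [::] -> s1 = [::] /\ s2 = [::].
Proof. by case: s1. Qed.

Lemma qtrue_ground M (v w : valuation M) (φ : qform Sig) : qvars φ = [::] ->
  qtrue v φ -> qtrue w φ.
Proof.
suff: qvars φ = [::] -> (qtrue v φ <-> qtrue w φ) by move=> H /H[].
have [Et Eh] := teval_ground v w.
elim: φ => [||s t u|p ts|φ IH|φ1 IH1 φ2 IH2|φ1 IH1 φ2 IH2] //=.
- by move=> /cat_nil[/Et-> /Et->].
- by move=> /Eh->.
- by move=> /IH->.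
- by move=> /cat_nil[/IH1-> /IH2->].
- by move=> /cat_nil[/IH1-> /IH2->].
Qed.

Lemma tsubst_ground (σ : subst Sig) :
  (forall s (t : term s), tvars t = [::] -> tsubst σ t = t) /\
  (forall l (h : hlist term l), hcat (@tvars Sig) h = [::] -> hmap (tsubst σ) h = h).
Proof.
apply: term_hlist_ind => //=; first by move=> f ts IH /IH->.
by move=> s l t ts IH1 IH2 /cat_nil[/IH1-> /IH2->].
Qed.

Lemma qsubst_ground (σ : subst Sig) φ : qvars φ = [::] -> qsubst σ φ = φ.
Proof.
have [Et Eh] := tsubst_ground σ.
elim: φ => [||s t u|p ts|φ IH|φ1 IH1 φ2 IH2|φ1 IH1 φ2 IH2] //=.
- by move=> /cat_nil[/Et-> /Et->].
- by move=> /Eh->.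
- by move=> /IH->.
- by move=> /cat_nil[/IH1-> /IH2->].
- by move=> /cat_nil[/IH1-> /IH2->].
Qed.

Lemma asubst_ground (σ : subst Sig) A : avars A = [::] -> asubst σ A = A.
Proof.
have [Et Eh] := tsubst_ground σ.
case: A => [p x|p x|p s q] /=.
- by move=> /cat_nil[/Et-> /Et->].
- by move=> /cat_nil[/Et-> /Et->].
- by move=> /cat_nil[/Et-> /cat_nil[/Et-> /Et->]].
Qed.
End Substitution.

(** Ground atoms as tuples; [Some true], [Some false], [None] stand for [knows],
    [uknows], [msg]. *)
Definition gatom (X : Type) : Type := option bool * X * X * X.

HB.instance Definition _ (X : finType) := Finite.on (gatom X).

Definition gmap X Y (f : X -> Y) (a : gatom X) : gatom Y :=
  (a.1.1.1, f a.1.1.2, f a.1.2, f a.2).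

Definition tval Sig M (v : @valuation Sig M) s (t : term Sig s) : {s & dom M s} :=
  Tagged (dom M) (teval v t).

Lemma tval_inj Sig M (v : @valuation Sig M) s (t u : term Sig s) :
  tval v t = tval v u -> teval v t = teval v u.
Proof. exact: Tagged_inj. Qed.

(** [Knows] and [Uknows] have two arguments; their infon is repeated to fill the last slot. *)
Definition aval Sig M (v : @valuation Sig M) (A : atom Sig) : gatom {s & dom M s} :=
  match A with
  | Knows p x => (Some true, tval v p, tval v x, tval v x)
  | Uknows p x => (Some false, tval v p, tval v x, tval v x)
  | Msg p s q => (None, tval v p, tval v s, tval v q)
  end.

(** * Least fixpoints over ground facts *)

Section States.
Variable Sig : signature.
Local Notation term := (term Sig).

Definition holds M (v : @valuation Sig M) (S : state Sig) (k : nat) g : Prop :=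
  exists2 f, S k f & qtrue v (fconstr f) /\ aval v (fatom f) = g.

Lemma tval_ground M (v w : valuation M) s (t : term s) : tvars t = [::] -> tval v t = tval w t.
Proof. by move=> H; rewrite /tval (proj1 (teval_ground v w) s t H). Qed.

Lemma aval_ground M (v w : valuation M) (A : atom Sig) : avars A = [::] -> aval v A = aval w A.
Proof.
case: A => [p x|p x|p s q] /=.
- by move=> /cat_nil[Hp Hx]; rewrite !(tval_ground v w).
- by move=> /cat_nil[Hp Hx]; rewrite !(tval_ground v w).
- by move=> /cat_nil[Hp /cat_nil[Hs Hq]]; rewrite !(tval_ground v w).
Qed.

Lemma valuation_inhabited (M : structure Sig) : exists v : valuation M, True.
Proof.
have H s : exists x : dom M s, True by case: (dom_inh M s) => x; exists x.
by exists (fun s _ => sval (cid (H s))).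
Qed.

Definition canonical_expansion M (S : state Sig) : expansion M :=
  Expansion
    (fun k a b => exists (v : valuation M) p x ξ,
       [/\ S k (Fact (Knows p x) ξ), qtrue v ξ, teval v p = a & teval v x = b])
    (fun k a b => exists (v : valuation M) p x ξ,
       [/\ S k (Fact (Uknows p x) ξ), qtrue v ξ, teval v p = a & teval v x = b])
    (fun k a b c => exists (v : valuation M) p s q ξ,
       S k (Fact (Msg p s q) ξ) /\
       [/\ qtrue v ξ, teval v p = a, teval v s = b & teval v q = c]).

Lemma canonical_expansion_least M S : least_expansion S (canonical_expansion M S).
Proof.
split=> [k [[p x|p x|p s q] ξ] Hf v Hv|E' HE'] /=.
- by exists v, p, x, ξ.
- by exists v, p, x, ξ.
- by exists v, p, s, q, ξ.
- split=> [k a b|k a b|k a b c] /=.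
  + by case=> v [p [x [ξ [/HE' H /H{}H <- <-]]]].
  + by case=> v [p [x [ξ [/HE' H /H{}H <- <-]]]].
  + by case=> v [p [s [q [ξ [/HE' H [/H{}H <- <- <-]]]]]].
Qed.

(** A least expansion lies below the canonical one, so a true atom is traced back to a fact of the
    state. That fact is read under its own valuation [w]; groundness later allows returning to
    [v]. *)
Lemma least_expansion_true M S (E : expansion M) v k A :
  least_expansion S E -> atom_true E v k A -> exists w, holds w S k (aval v A).
Proof.
case=> _ /(_ _ (proj1 (canonical_expansion_least M S)))[H1 H2 H3].
case: A => [p x|p x|p s q] /= => [/H1|/H2|/H3].
- by case=> w [p' [x' [ξ [Hf Hw E1 E2]]]]; exists w, (Fact (Knows p' x') ξ);
    rewrite //= /tval E1 E2.
- by case=> w [p' [x' [ξ [Hf Hw E1 E2]]]]; exists w, (Fact (Uknows p' x') ξ);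
    rewrite //= /tval E1 E2.
- by case=> w [p' [s' [q' [ξ [Hf [Hw E1 E2 E3]]]]]]; exists w, (Fact (Msg p' s' q') ξ);
    rewrite //= /tval E1 E2 E3.
Qed.

Lemma canonical_expansion_true M (S : state Sig) (v : valuation M) k A :
  holds v S k (aval v A) -> atom_true (canonical_expansion M S) v k A.
Proof.
case=> -[B ξ] /= HS [Hv]; case: B HS => [p x|p x|p s q] HS; case: A => [p' x'|p' x'|p' s' q'] //=.
- by case=> /tval_inj <- /tval_inj <- _; exists v, p, x, ξ.
- by case=> /tval_inj <- /tval_inj <- _; exists v, p, x, ξ.
- by case=> /tval_inj <- /tval_inj <- /tval_inj <-; exists v, p, s, q, ξ.
Qed.

Lemma holds_ground M (v w : valuation M) S k g : (forall j f, S j f -> ground_fact f) ->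
  holds v S k g -> holds w S k g.
Proof.
move=> gr [f Hf [Hv <-]]; have [ga gc] := gr _ _ Hf.
by exists f => //; split; [exact: qtrue_ground Hv | exact: aval_ground].
Qed.

(** Expansions are eliminated: the canonical one is least, and groundness lets a single valuation
    serve for all facts. *)
Lemma state_satisfiableP T S k (G : seq (fact Sig)) : (forall j f, S j f -> ground_fact f) ->
  (forall g, List.In g G -> ground_fact g) ->
  state_satisfiable T S k G <->
  exists M (v : valuation M), model T M /\
    forall g, List.In g G -> qtrue v (fconstr g) -> holds v S k (aval v (fatom g)).
Proof.
move=> grS grG; split=> [[M [E [Mm HE HG]]]|[M [v [Mm HG]]]].
  have [v _] := valuation_inhabited M; exists M, v; split=> // g Hg Hc.
  have [w Hw] := least_expansion_true HE (HG _ Hg v Hc).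
  exact: holds_ground Hw.
exists M, (canonical_expansion M S); split=> //; first exact: canonical_expansion_least.
move=> g Hg w Hc; have [ga gc] := grG _ Hg.
apply: canonical_expansion_true; apply: (@holds_ground _ v w _ _ _ grS).
by rewrite (aval_ground w v ga); apply: HG => //; apply: qtrue_ground Hc.
Qed.

Lemma lfp_closed P k (f : fact Sig) : immediate P (lfp P) k f -> lfp P k f.
Proof.
case=> r [σ [fs [Pr gr [Es Hfs] ->]]] S HS; apply: (HS); exists r, σ, fs.
by split=> //; split=> // g /Hfs; apply.
Qed.

Lemma lfp_rule P k (f : fact Sig) : lfp P k f -> exists r, P k r.
Proof.
move/(_ (fun j _ => exists r, P j r)); apply=> j g [r [σ [fs [Pr _ _ _]]]].
by exists r.
Qed.

Lemma qvars_QAll (φs : seq (qform Sig)) : qvars (QAll φs) = flatten (map (@qvars Sig) φs).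
Proof. by elim: φs => //= φ φs ->. Qed.

Lemma qvars_atom_eq (A B : atom Sig) : avars A = [::] -> avars B = [::] ->
  qvars (atom_eq A B) = [::].
Proof.
case: A => [p x|p x|p s q]; case: B => [p' x'|p' x'|p' s' q'] //=.
- by move=> /cat_nil[-> ->] /cat_nil[-> ->].
- by move=> /cat_nil[-> ->] /cat_nil[-> ->].
- by move=> /cat_nil[-> /cat_nil[-> ->]] /cat_nil[-> /cat_nil[-> ->]].
Qed.

(** Groundness is a pre-fixpoint: [resolve] only combines ground constraints and equations between
    ground atoms. *)
Lemma lfp_ground P k (f : fact Sig) : lfp P k f -> ground_fact f.
Proof.
move/(_ (fun _ f => ground_fact f)); apply=> j g [r [σ [fs [_ [gh gb] [_ Hfs] ->]]]].
case: (rule_subst σ r) gh gb => A0 As ξ gh /cat_nil[/= gb gξ]; split=> //=.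
rewrite gξ /= qvars_QAll; rewrite /= in gh.
elim: As fs Hfs gb => [|A As IH] [|h fs] //= Hfs /cat_nil[gA gAs].
have [ga ->] := Hfs h (or_introl erefl); rewrite qvars_atom_eq //=.
by apply: IH => // h' Hh'; apply: Hfs; right.
Qed.

(** Derivability inside one model, with constraints evaluated at once instead of being accumulated
    in a formula. *)
Inductive der M (v : @valuation Sig M) (P : rule Sig -> Prop) : gatom {s & dom M s} -> Prop :=
| Der r σ : P r -> ground_rule (rule_subst σ r) -> qtrue v (rconstr (rule_subst σ r)) ->
    (forall A, List.In A (rbody (rule_subst σ r)) -> der v P (aval v A)) ->
    der v P (aval v (rhead (rule_subst σ r))).

Lemma qtrue_atom_eq M (v : valuation M) (A B : atom Sig) :
  qtrue v (atom_eq A B) <-> aval v A = aval v B.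
Proof.
case: A => [p x|p x|p s q]; case: B => [p' x'|p' x'|p' s' q'] //=; rewrite /tval; split=> //.
- by case=> -> ->.
- by case=> /tval_inj-> /tval_inj->.
- by case=> -> ->.
- by case=> /tval_inj-> /tval_inj->.
- by case=> -> [-> ->].
- by case=> /tval_inj-> /tval_inj-> /tval_inj->.
Qed.

(** Left to right, the property that a true constraint makes the atom derivable is a pre-fixpoint.
    Right to left, each body atom yields by induction a fact of the same value, and resolving with
    these facts gives a true constraint. *)
Lemma lfp_holds M (v : valuation M) P k g : holds v (lfp P) k g <-> der v (P k) g.
Proof.
split=> [[f Hf [Hc <-]]|].
  move: Hc; apply: (Hf (fun j f => qtrue v (fconstr f) -> der v (P j) (aval v (fatom f)))).
  move=> j {Hf}f [r [σ [fs [Pr gr [Es Hfs] ->]]]] /= [Hc Hall]; apply: Der => // A HA.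
  rewrite -(size_map (asubst σ)) in Es.
  move: HA Hall Hfs Es => /=; elim: (map _ (rbody r)) fs => //= B Bs IH [|h fs] //=.
  case=> [<-|HA] [[Hh /qtrue_atom_eq Eh] Hall] Hfs [Es].
    by rewrite Eh; apply: Hfs => //; left.
  by apply: IH HA Hall _ Es => h' Hh'; apply: Hfs; right.
elim=> r σ Pr gr Hc _ IH.
suff [fs [Es Hfs Hall]] : exists fs, [/\ size fs = size (rbody r),
    forall h, List.In h fs -> lfp P k h
  & qtrue v (QAll [seq QAnd (fconstr Af.2) (atom_eq Af.1 (fatom Af.2))
                  | Af <- zip (rbody (rule_subst σ r)) fs])].
  exists (resolve (rule_subst σ r) fs) => //; apply: lfp_closed.
  by exists r, σ, fs.
have -> : size (rbody r) = size (rbody (rule_subst σ r)) by rewrite /= size_map.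
elim: (rbody (rule_subst σ r)) IH => [|A As IHA] IH.
  by exists [::]; split=> // h [].
have [fs [Es Hfs Hall]] := IHA (fun B HB => IH B (or_intror HB)).
have [f Hf [Hfc Ef]] := IH A (or_introl erefl).
exists (f :: fs); split=> /=; [by rewrite Es | by move=> h [<-|/Hfs] |].
by split=> //; split=> //; apply/qtrue_atom_eq.
Qed.
End States.

(** * Translation of rules into clauses *)

Section Representatives.
Variables (Sig : signature) (T : theory Sig) (K : nat) (gt : 'I_K -> sterm Sig).
Local Notation term := (term Sig).

Definition rval M (v : valuation M) (i : 'I_K) := tval v (tagged (gt i)).

Definition rep s (u : term s) (i : 'I_K) : Prop :=
  forall M (v : valuation M), model T M -> tval v u = rval v i.

Hypothesis gt_ground : forall i, tvars (tagged (gt i)) = [::].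
Hypothesis gt_repr : forall s (u : term s), tvars u = [::] ->
  exists i, tag (gt i) = s /\ rep u i.

(** The summand 2 covers the built-in symbols. A common bound makes the type of argument lists
    finite. *)
Definition arity_bound : nat :=
  2 + \max_(e : xfun Sig) size (xfun_args e) + \max_(e : xpred Sig) size (xpred_args e).

Lemma fargs_bound (f : fsym Sig) : size (fargs f) <= arity_bound.
Proof.
case: f => [||||e] //=; rewrite /arity_bound ?addSn //.
rewrite add0n; do 2! apply: leqW; apply: leq_trans (leq_addr _ _).
exact: (leq_bigmax (F := fun e => size (xfun_args e))).
Qed.

Lemma pargs_bound (p : psym Sig) : size (pargs p) <= arity_bound.
Proof.
case: p => [|e] //=; rewrite /arity_bound ?addSn //.
rewrite add0n; do 2! apply: leqW; apply: leq_trans (leq_addl _ _).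
exact: (leq_bigmax (F := fun e => size (xpred_args e))).
Qed.

Definition fnum (f : fsym Sig) : nat :=
  match f with
  | a2i => 0 | s2i => 1 | said => 2 | tdOn => 3
  | other_fun e => 4 + enum_rank e
  end.

Definition pnum (p : psym Sig) : nat :=
  match p with prim => 0 | other_pred e => 1 + enum_rank e end.

Lemma fnum_inj : injective fnum.
Proof.
by case=> [||||e] [||||e'] //= [] /val_inj/enum_rank_inj->.
Qed.

Lemma pnum_inj : injective pnum.
Proof. by case=> [|e] [|e'] //= [] /val_inj/enum_rank_inj->. Qed.

Lemma fnum_bound f : fnum f <= 3 + #|xfun Sig|.
Proof. by case: f => //= e; rewrite !addSn !ltnS add0n ltn_ord. Qed.

Lemma pnum_bound p : pnum p <= #|xpred Sig|.
Proof. by case: p => //= e; rewrite add1n ltn_ord. Qed.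

Local Notation V := (option 'I_K).
Local Notation args := {bseq arity_bound of V}.

(** The ground atomic formulas over the representatives; a world is the set of
    those that hold in a given model. *)
Definition gform : Type := ('I_K * 'I_K + 'I_(#|xpred Sig|).+1 * args)%type.
HB.instance Definition _ := Finite.on gform.

Definition gform_true M (v : @valuation Sig M) (g : gform) : Prop :=
  match g with
  | inl ij => rval v ij.1 = rval v ij.2
  | inr (n, gs) => exists p js (a : hlist (dom M) (pargs p)),
      [/\ pnum p = n, seqopt gs = Some js, hseq a = map (rval v) js & pint a]
  end.

Local Notation W := {set gform}.

Definition world M (v : @valuation Sig M) : W := [set g | `[< gform_true v g >]].

(** A classical choice of a representative equal to the application in every model. Symbols enter by
    number, which keeps their typing out of the table. *)
Definition fun_table (n : nat) (gs : seq V) : V :=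
  if seqopt gs is Some js then
    [pick j | `[< exists2 f, fnum f = n &
       forall M (v : valuation M), model T M -> exists2 a : hlist (dom M) (fargs f),
         hseq a = map (rval v) js & rval v j = Tagged (dom M) (fint a) >]]
  else None.

Definition pred_table (n : 'I_(#|xpred Sig|).+1) (gs : args) : option {set W} :=
  if seqopt gs is Some _ then Some [set w : W | inr (n, gs) \in w] else None.

Definition eq_table : V -> V -> option {set W} := omap2 (fun i j => [set w : W | inl (i, j) \in w]).

(** Whether a tree stands for a term, an argument list, a formula, ... is not known
    before its context is: all readings are evaluated at once. [rapp], [rpred],
    [reql], [rpair], [rand], [ror] are the readings as what follows the mark of a
    syntax node. *)
Local Notation FV := (option {set W}).
Definition roles : Type := (V * args * V * (FV * FV * FV) * (FV * FV * FV))%type.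
HB.instance Definition _ := Finite.on roles.

Definition rterm (x : roles) : V := x.1.1.1.1.
Definition rargs (x : roles) : args := x.1.1.1.2.
Definition rapp (x : roles) : V := x.1.1.2.
Definition rpred (x : roles) : FV := x.1.2.1.1.
Definition rpair (x : roles) : FV := x.1.2.1.2.
Definition reql (x : roles) : FV := x.1.2.2.
Definition rform (x : roles) : FV := x.2.1.1.
Definition rand (x : roles) : FV := x.2.1.2.
Definition ror (x : roles) : FV := x.2.2.

Definition roles0 : roles :=
  (None, [bseq], None, (None, None, None), (None, None, None)).

Definition roles_step (c : 'I_7) (cf : 'I_(4 + #|xfun Sig|)) (cp : 'I_(#|xpred Sig|).+1)
    (lk : V) (x y : roles) : roles :=
  (if c == 0 :> nat then lk else rapp y,
   insub_bseq arity_bound (rterm x :: rargs y),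
   fun_table cf (rargs y),
   (pred_table cp (rargs y), eq_table (rterm x) (rterm y), rpair y),
   (match c : nat with
    | 0 => Some setT
    | 1 => Some set0
    | 2 => reql y
    | 3 => rpred y
    | 4 => omap (@setC _) (rform y)
    | 5 => rand y
    | _ => ror y
    end, omap2 (@setI _) (rform x) (rform y), omap2 (@setU _) (rform x) (rform y))).

Local Notation entry := {ffun 'I_4 -> V}.

(** An entry of the wrong sort counts as unassigned, so that every list of entries decodes to a
    well-sorted assignment. *)
Definition lookup (e : nat -> entry) (b : data) : V :=
  let s := capped 3 (fstd b) in
  if e (spine (sndd b)) s is Some i then
    if tag (gt i) == sort_of_nat s then Some i else None
  else None.

Definition ev_step (e : nat -> entry) (a b : data) (x y : roles) : roles :=
  roles_step (capped 6 a) (capped (3 + #|xfun Sig|) a) (capped #|xpred Sig| a) (lookup e b) x y.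

Definition ev (e : nat -> entry) (d : data) : roles := tfold roles0 (ev_step e) d.

Lemma evE e a b : ev e (Node a b) = ev_step e a b (ev e a) (ev e b).
Proof. by []. Qed.

Lemma rterm_mark e k b : k <= 6 ->
  rterm (ev e (mark k b)) = if k == 0 then lookup e b else rapp (ev e b).
Proof. by move=> H; rewrite /mark evE /rterm /= capped_num. Qed.

Lemma rform_mark e k b : k <= 6 ->
  rform (ev e (mark k b)) =
    match k with
    | 0 => Some setT
    | 1 => Some set0
    | 2 => reql (ev e b)
    | 3 => rpred (ev e b)
    | 4 => omap (@setC _) (rform (ev e b))
    | 5 => rand (ev e b)
    | _ => ror (ev e b)
    end.
Proof. by move=> H; rewrite /mark evE /rform /= capped_num. Qed.

Lemma rargs_ev e a b : size (rargs (ev e b)) < arity_bound ->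
  rargs (ev e (Node a b)) = rterm (ev e a) :: rargs (ev e b) :> seq V.
Proof. by move=> H; rewrite evE {1}/rargs /= /insub_bseq val_insubd /= H. Qed.

(** A variable index in [d] is the length of a spine inside [d], hence below [tsize d]. *)
Lemma ev_agree e e' N d : (forall n, n < N -> e n = e' n) -> tsize d <= N -> ev e d = ev e' d.
Proof.
move=> E; elim: d => // a IHa b IHb H.
have Ha : tsize a <= N by rewrite (leq_trans _ H) // leqW ?leq_addr.
have Hb : tsize b < N by rewrite (leq_trans _ H) // ltnS leq_addl.
rewrite !evE IHa // IHb ?(ltnW Hb) //.
have Hs : spine (sndd b) < N.
  apply: leq_ltn_trans Hb; case: (b) => //= c1 c2.
  by rewrite (leq_trans (spine_tsize _)) // leqW // leq_addl.
by rewrite /ev_step /lookup E.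
Qed.

(** What follows [p] in the code is read both whole, as [x], and split, as [s] and [q]. *)
Definition atom_table (k : 'I_3) (p x s q : V) : option (gatom 'I_K) :=
  if k == 2 :> nat
  then omap2 (fun p sq => (None, p, sq.1, sq.2)) p (omap2 pair s q)
  else omap2 (fun p x => (Some (k == 0 :> nat), p, x, x)) p x.

Definition ev_atom (e : nat -> entry) (d : data) : option (gatom 'I_K) :=
  let t := sndd (sndd d) in
  atom_table (capped 2 (fstd d)) (rterm (ev e (fstd (sndd d)))) (rterm (ev e t))
    (rterm (ev e (fstd t))) (rterm (ev e (sndd t))).

Lemma ev_atom_mark e k a b : k <= 2 ->
  ev_atom e (mark k (Node a b)) =
    if k == 2
    then omap2 (fun p sq => (None, p, sq.1, sq.2)) (rterm (ev e a))
           (omap2 pair (rterm (ev e (fstd b))) (rterm (ev e (sndd b))))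
    else omap2 (fun p x => (Some (k == 0), p, x, x)) (rterm (ev e a)) (rterm (ev e b)).
Proof. by move=> H; rewrite /mark /ev_atom /= /atom_table capped_num. Qed.

Definition body_step (e : nat -> entry) (a _ : data) (_ B : option {set gatom 'I_K}) :=
  omap2 (fun A B => A |: B) (ev_atom e a) B.

Definition ev_body (e : nat -> entry) : data -> option {set gatom 'I_K} :=
  tfold (Some set0) (body_step e).

(** A ground instance of a rule: head, body, worlds where the constraint holds. *)
Local Notation clause := (gatom 'I_K * {set gatom 'I_K} * {set W})%type.

Definition ev_clause (e : nat -> entry) (d : data) : option clause :=
  omap2 (fun h bc => (h, bc.1, bc.2)) (ev_atom e (fstd d))
    (omap2 pair (ev_body e (fstd (sndd d))) (rform (ev e (sndd (sndd d))))).

Lemma tsize_fstd d : tsize (fstd d) <= tsize d.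
Proof. by case: d => //= a b; rewrite leqW ?leq_addr. Qed.

Lemma tsize_sndd d : tsize (sndd d) <= tsize d.
Proof. by case: d => //= a b; rewrite leqW ?leq_addl. Qed.

Lemma ev_clause_agree e e' d : (forall n, n < tsize d -> e n = e' n) ->
  ev_clause e d = ev_clause e' d.
Proof.
move=> E.
have S1 c : tsize c <= tsize d -> tsize (fstd c) <= tsize d := leq_trans (tsize_fstd c).
have S2 c : tsize c <= tsize d -> tsize (sndd c) <= tsize d := leq_trans (tsize_sndd c).
have Ea c : tsize c <= tsize d -> ev_atom e c = ev_atom e' c.
  by move=> H; rewrite /ev_atom !(ev_agree E) ?S1 ?S2 ?S1 ?S2.
have Eb c : tsize c <= tsize d -> ev_body e c = ev_body e' c.
  rewrite /ev_body; elim: c => // a _ b IH H /=.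
  by rewrite IH ?(S2 _ H) // /body_step Ea ?(S1 _ H).
by rewrite /ev_clause Ea ?S1 // Eb ?S1 ?S2 // (ev_agree E) ?S2.
Qed.

Definition entry_of (l : data) (n : nat) : entry := decode_fin [ffun=> None] (dnth l n).

Definition clauses_step (d l _ : data) (_ C : {set clause}) : {set clause} :=
  (if ev_clause (entry_of l) d is Some c then [set c] else set0) :|: C.

Definition rule_clauses (d : data) : {set clause} :=
  tfold set0 (clauses_step d) (all_lists entry d).

(** Infinite assignments may replace the enumerated lists, since only indices below [tsize d]
    matter. *)
Lemma rule_clausesP d c :
  c \in rule_clauses d <-> exists e, ev_clause e d = Some c.
Proof.
have H : c \in rule_clauses d <->
    exists2 l, dmem l (all_lists entry d) & ev_clause (entry_of l) d = Some c.
  rewrite /rule_clauses; elim: (all_lists entry d) => /= [|l _ m IH].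
    by rewrite inE; split=> // -[].
  rewrite /clauses_step inE; split.
  - case/orP=> [|/IH[l' Hl' El']]; last by exists l' => //; right.
    case El: (ev_clause _ _) => [c'|]; last by rewrite inE.
    by rewrite inE => /eqP->; exists l => //; left.
  - case=> l' [->|Hl'] El'; apply/orP; first by left; rewrite El' inE.
    by right; apply/IH; exists l'.
rewrite H; split=> [[l _ E]|[e E]]; first by exists (entry_of l).
have [l Hl El] := all_listsP e d; exists l => //.
by rewrite -E; apply: ev_clause_agree => n Hn; rewrite /entry_of El // code_finK.
Qed.

(** * The translation into clauses is recursive *)

Lemma finrec_entry_of l b : recursive l -> recursive b ->
  finrec (fun z => entry_of (l z) (spine (b z))).
Proof. by move=> Hl Hb; exact: (finrec_comp (finrec_decode _) (rec_dnth Hl Hb)). Qed.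

Lemma finrec_lookup l b : recursive l -> recursive b ->
  finrec (fun z => lookup (entry_of (l z)) (b z)).
Proof.
move=> Hl Hb.
have H1 := finrec_entry_of Hl (rec_comp rec_snd Hb).
have H2 := finrec_comp (finrec_capped 3) (rec_comp rec_fst Hb).
exact: (finrec_map2 (fun (e : entry) (s : 'I_4) =>
  if e s is Some i then if tag (gt i) == sort_of_nat s then Some i else None else None) H1 H2).
Qed.

Lemma finrec_ev l c : recursive l -> recursive c -> finrec (fun z => ev (entry_of (l z)) (c z)).
Proof.
move=> Hl Hc; apply: (@finrec_tfold _ _ (fun l => ev_step (entry_of l))) => // x y.
have r1 : recursive (fun z => fstd (sndd z)) := rec_comp rec_fst rec_snd.
have r2 : recursive (fun z => sndd (sndd z)) := rec_comp rec_snd rec_snd.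
have H1 := finrec_comp (finrec_capped 6) r1.
have H2 := finrec_comp (finrec_capped (3 + #|xfun Sig|)) r1.
have H3 := finrec_comp (finrec_capped #|xpred Sig|) r1.
have H4 := finrec_lookup rec_fst r2.
(* Arguments are grouped in pairs to fit the two functions of [finrec_map2]. *)
have H12 := finrec_map2 (@pair _ _) H1 H2.
have H34 := finrec_map2 (@pair _ _) H3 H4.
exact: (finrec_map2 (fun u w => roles_step u.1 u.2 w.1 w.2 x y) H12 H34).
Qed.

Lemma finrec_ev_atom l c : recursive l -> recursive c ->
  finrec (fun z => ev_atom (entry_of (l z)) (c z)).
Proof.
move=> Hl Hc.
have r1 := rec_comp rec_fst (rec_comp rec_snd Hc).
have r2 := rec_comp rec_snd (rec_comp rec_snd Hc).
have H0 := finrec_comp (finrec_capped 2) (rec_comp rec_fst Hc).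
have H1 := finrec_map rterm (finrec_ev Hl r1).
have H2 := finrec_map rterm (finrec_ev Hl r2).
have H3 := finrec_map rterm (finrec_ev Hl (rec_comp rec_fst r2)).
have H4 := finrec_map rterm (finrec_ev Hl (rec_comp rec_snd r2)).
have H12 := finrec_map2 (@pair _ _) H1 H2.
have H34 := finrec_map2 (@pair _ _) H3 H4.
have H := finrec_map2 (@pair _ _) H12 H34.
exact: (finrec_map2 (fun k u => atom_table k u.1.1 u.1.2 u.2.1 u.2.2) H0 H).
Qed.

Lemma finrec_ev_body l c : recursive l -> recursive c ->
  finrec (fun z => ev_body (entry_of (l z)) (c z)).
Proof.
move=> Hl Hc; apply: (@finrec_tfold _ _ (fun l => body_step (entry_of l))) => // x y.
have H := finrec_ev_atom rec_fst (rec_comp rec_fst rec_snd).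
exact: (finrec_map (fun A => omap2 (fun A B => A |: B) A y) H).
Qed.

Lemma finrec_ev_clause l c : recursive l -> recursive c ->
  finrec (fun z => ev_clause (entry_of (l z)) (c z)).
Proof.
move=> Hl Hc.
have H1 := finrec_ev_atom Hl (rec_comp rec_fst Hc).
have H2 := finrec_ev_body Hl (rec_comp rec_fst (rec_comp rec_snd Hc)).
have H3 := finrec_map rform (finrec_ev Hl (rec_comp rec_snd (rec_comp rec_snd Hc))).
exact: (finrec_map2 _ H1 (finrec_map2 _ H2 H3)).
Qed.

Lemma finrec_rule_clauses : finrec rule_clauses.
Proof.
apply: (@finrec_tfold _ _ clauses_step id) => [x y||].
- have H := finrec_ev_clause (rec_comp rec_fst rec_snd) rec_fst.
  exact: (finrec_map (fun o => (if o is Some c then [set c] else set0) :|: y) H).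
- exact: rec_id.
- exact: rec_all_lists.
Qed.

(** * Correctness of the translation *)

Definition coherent (σ : subst Sig) (e : nat -> entry) : Prop :=
  forall s n, ospec (lookup e (code_var (s, n))) (tvars (σ s n)) (rep (σ s n)).

Lemma lookup_var e s n : lookup e (code_var (s, n)) =
  if e n (inord (nat_of_sort s)) is Some i then if tag (gt i) == s then Some i else None
  else None.
Proof.
rewrite /lookup /= spine_num.
have -> : capped 3 (num (nat_of_sort s)) = inord (nat_of_sort s).
  by apply: val_inj; rewrite /= capped_num ?inordK //; case: s.
by rewrite inordK ?nat_of_sortK //; case: s.
Qed.

(** Each ground value of [σ] is replaced with a representative; the other variables stay
    unassigned. *)
Lemma coherent_entry σ : exists e, coherent σ e.
Proof.
pose P s n (i : 'I_K) := `[< [/\ tvars (σ s n) = [::], tag (gt i) = s & rep (σ s n) i] >].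
exists (fun n => [ffun s : 'I_4 => [pick i | P (sort_of_nat s) n i]]) => s n.
rewrite lookup_var ffunE inordK; last by case: s.
rewrite nat_of_sortK; case: pickP => [i /asboolP[g /eqP-> r]|H] /=; first by split.
by move=> g; have [i [t r]] := gt_repr g; have /asboolP[] := H i; split.
Qed.

(** An assigned variable is sent to its representative, an unassigned one to itself, which is not
    ground. *)
Lemma coherent_subst e : exists σ, coherent σ e.
Proof.
have H s n : exists t : term s, ospec (lookup e (code_var (s, n))) (tvars t) (rep t).
  case E: (lookup e (code_var (s, n))) => [i|] /=; last by exists (Var Sig s n).
  have: tag (gt i) = s.
    by move: E; rewrite lookup_var; case: (e _ _) => // j; case: eqP => // <- [<-].
  case E': (gt i) => [s' t] /= Es; case: _ / Es; exists t.
  by have := gt_ground i; rewrite E' => gr; split=> // M v _; rewrite /rval E'.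
exists (fun s n => sval (cid (H s n))) => s n; exact: (svalP (cid (H s n))).
Qed.

Definition same_truth (φ : qform Sig) (S : {set W}) : Prop :=
  forall M (v : valuation M), model T M -> (world v \in S <-> qtrue v φ).

(** Bodies are compared as sets of values: order, repetition and the choice among equal
    representatives do not matter. *)
Definition same_atoms (As : seq (atom Sig)) (B : {set gatom 'I_K}) : Prop :=
  forall M (v : valuation M), model T M -> forall g,
    (exists2 A, List.In A As & aval v A = g) <-> (exists2 b, b \in B & gmap (rval v) b = g).

Definition same_atom (A : atom Sig) (a : gatom 'I_K) : Prop :=
  forall M (v : valuation M), model T M -> aval v A = gmap (rval v) a.

Definition same_rule (r : rule Sig) (c : clause) : Prop :=
  [/\ same_atom (rhead r) c.1.1, same_atoms (rbody r) c.1.2 & same_truth (rconstr r) c.2].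

Section Evaluation.
Variables (σ : subst Sig) (e : nat -> entry).
Hypothesis coh : coherent σ e.

Definition reps l (h : hlist term l) (js : seq 'I_K) : Prop :=
  forall M (v : valuation M), model T M -> hseq (hmap (teval v) h) = map (rval v) js.

(** An entry exists because the representative of the ground term [App ts] qualifies. Any entry
    picked is correct, as numbers determine symbols and [hseq] determines the arguments. *)
Lemma fun_tableP f (ts : hlist term (fargs f)) gs :
  ospec (seqopt gs) (hcat (@tvars Sig) ts) (reps ts) ->
  ospec (fun_table (fnum f) gs) (tvars (App ts)) (rep (App ts)).
Proof.
rewrite /fun_table /=; case: (seqopt gs) => //= js [gr R].
have [j [_ Rj]] := gt_repr (u := App ts) gr.
case: pickP => [j' /asboolP[f' /fnum_inj-> H]|/(_ j)/asboolP[]] /=.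
  split=> // M v Mm; have [a Ea ->] := H M v Mm.
  by move: Ea; rewrite -R // => /hseq_inj->.
by exists f => // M v Mm; exists (hmap (teval v) ts); rewrite -?R // -Rj.
Qed.

(** The bound on [size l] ensures that [insub_bseq] keeps the whole argument list. *)
Lemma ev_term :
  (forall s (t : term s), ospec (rterm (ev e (code_term t)))
     (tvars (tsubst σ t)) (rep (tsubst σ t))) /\
  (forall l (h : hlist term l), size l <= arity_bound ->
     size (rargs (ev e (hcode (@code_term Sig) h))) = size l /\
     ospec (seqopt (rargs (ev e (hcode (@code_term Sig) h))))
       (hcat (@tvars Sig) (hmap (tsubst σ) h)) (reps (hmap (tsubst σ) h))).
Proof.
apply: term_hlist_ind.
- by move=> s n; rewrite [code_term _]/= rterm_mark //; apply: coh.
- move=> f ts /(_ (fargs_bound f))[_ IH].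
  rewrite [code_term _]/= rterm_mark // evE /rapp /=.
  have -> : code_fsym f = num (fnum f) by case: f {ts IH}.
  by rewrite capped_num ?fnum_bound //; apply: fun_tableP.
- by move=> _; split.
- move=> s l t ts IHt IHts /= Hl; have [sz IH] := IHts (ltnW Hl).
  rewrite rargs_ev /= ?sz //; split=> //.
  apply: ospec_map2 IHt IH _ => i js R Rs M v Mm.
  by rewrite /hseq /=; congr (_ :: _); [apply: R | apply: Rs].
Qed.

Lemma ev_form φ :
  ospec (rform (ev e (code_qform φ))) (qvars (qsubst σ φ)) (same_truth (qsubst σ φ)).
Proof.
have [Et Eh] := ev_term.
elim: φ => [||s t u|p ts|φ IH|φ1 IH1 φ2 IH2|φ1 IH1 φ2 IH2];
  rewrite [code_qform _]/= rform_mark //=.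
- by split=> // M v _; rewrite inE.
- by split=> // M v _; rewrite inE.
- rewrite /reql /= /rpair /=; apply: ospec_map2 (Et _ t) (Et _ u) _ => i j Ri Rj M v Mm.
  rewrite !inE; split=> [/asboolP /=|E]; first by rewrite -Ri // -Rj // => /tval_inj.
  by apply/asboolP; rewrite /= -Ri // -Rj // /tval E.
- rewrite /rpred /= /pred_table.
  have [_] := Eh _ ts (pargs_bound p); case E: (seqopt _) => [js|] //= [gr R].
  split=> // M v Mm; rewrite !inE.
  have -> : code_psym p = num (pnum p) by case: p {ts E gr R}.
  have En : capped #|xpred Sig| (num (pnum p)) = pnum p :> nat.
    by rewrite capped_num ?pnum_bound.
  split=> [/asboolP[p' [js' [a []]]]|H].
    (* Numbers determine symbols, so [p'] is [p] and the stored arguments are the values of [ts]. *)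
    rewrite En => /pnum_inj Ep; move: a; rewrite Ep => a; rewrite E => -[<-].
    by rewrite -R // => /hseq_inj->.
  by apply/asboolP; exists p, js, (hmap (teval v) (hmap (tsubst σ) ts)); rewrite En -R.
- apply: ospec_map IH _ => S HS M v Mm.
  by rewrite inE /= -HS //; split=> [/negP|/negP].
- apply: ospec_map2 IH1 IH2 _ => S1 S2 H1 H2 M v Mm.
  by rewrite inE /= -H1 // -H2 //; split=> [/andP|/andP].
- apply: ospec_map2 IH1 IH2 _ => S1 S2 H1 H2 M v Mm.
  by rewrite inE /= -H1 // -H2 //; split=> [/orP|/orP].
Qed.

Lemma ev_atomP A :
  ospec (ev_atom e (code_atom A)) (avars (asubst σ A)) (same_atom (asubst σ A)).
Proof.
have [Et _] := ev_term.
case: A => [p x|p x|p s q]; rewrite [code_atom _]/= ev_atom_mark //=.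
- apply: ospec_map2 (Et _ p) (Et _ x) _ => i j Ri Rj M v Mm.
  by rewrite /gmap /= -Ri // -Rj.
- apply: ospec_map2 (Et _ p) (Et _ x) _ => i j Ri Rj M v Mm.
  by rewrite /gmap /= -Ri // -Rj.
- have Esq := ospec_map2 (f := pair) (Et _ s) (Et _ q)
    (Q := fun ij => rep (tsubst σ s) ij.1 /\ rep (tsubst σ q) ij.2)
    (fun i j Ri Rj => conj Ri Rj).
  apply: ospec_map2 (Et _ p) Esq _ => i [j k] Ri [/= Rj Rk] M v Mm.
  by rewrite /gmap /= -Ri // -Rj // -Rk.
Qed.

Lemma ev_bodyP As :
  ospec (ev_body e (code_seq (@code_atom Sig) As)) (flatten (map (@avars Sig) (map (asubst σ) As)))
    (same_atoms (map (asubst σ) As)).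
Proof.
elim: As => [|A As IH] /=.
  by split=> // M v _ g; split=> -[x] //; rewrite inE.
rewrite /body_step; apply: ospec_map2 (ev_atomP A) IH _ => a B Ra RB M v Mm g; split.
- case=> A' [<-|HA'] <-; first by exists a; rewrite ?setU11 // Ra.
  have /(RB M v Mm)[b Hb <-] : exists2 A, List.In A (map (asubst σ) As) & aval v A = aval v A'.
    by exists A'.
  by exists b; rewrite // inE Hb orbT.
- case=> b; rewrite !inE => /orP[/eqP->|Hb] <-.
    by exists (asubst σ A); [left | rewrite Ra].
  have /(RB M v Mm)[A' HA' <-] : exists2 b', b' \in B & gmap (rval v) b' = gmap (rval v) b.
    by exists b.
  by exists A' => //; right.
Qed.

Lemma ev_clauseP r :
  ospec (ev_clause e (code_rule r))
    (avars (rhead (rule_subst σ r)) ++ body_vars (rule_subst σ r))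
    (same_rule (rule_subst σ r)).
Proof.
have Ebc := ospec_map2 (f := pair) (ev_bodyP (rbody r)) (ev_form (rconstr r))
  (Q := fun bc => same_atoms (map (asubst σ) (rbody r)) bc.1 /\
                  same_truth (qsubst σ (rconstr r)) bc.2)
  (fun i j Ri Rj => conj Ri Rj).
by apply: ospec_map2 (ev_atomP (rhead r)) Ebc _ => h [b c] Rh [Rb Rc].
Qed.

End Evaluation.

Lemma ground_ruleE (r : rule Sig) :
  ground_rule r <-> avars (rhead r) ++ body_vars r = [::].
Proof. by split=> [[-> ->]|/cat_nil[]]. Qed.

(** The substitution is arbitrary: replacing its ground values with representatives lands among
    finitely many clauses. *)
Lemma rule_clauses_complete r σ : ground_rule (rule_subst σ r) ->
  exists2 c, c \in rule_clauses (code_rule r) & same_rule (rule_subst σ r) c.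
Proof.
move=> /ground_ruleE gr; have [e coh] := coherent_entry σ.
have := ev_clauseP coh r; case E: (ev_clause e _) => [c|] //= [_ H].
by exists c => //; apply/rule_clausesP; exists e.
Qed.

Lemma rule_clauses_sound r c : c \in rule_clauses (code_rule r) ->
  exists2 σ, ground_rule (rule_subst σ r) & same_rule (rule_subst σ r) c.
Proof.
move=> /rule_clausesP[e E]; have [σ coh] := coherent_subst e; exists σ;
  by have := ev_clauseP coh r; rewrite E => -[/ground_ruleE].
Qed.

(** * Runs and sets of message clauses *)

Inductive clause_der M (v : @valuation Sig M) (cs : {set clause}) : gatom {s & dom M s} -> Prop :=
| ClauseDer c : c \in cs -> world v \in c.2 ->
    (forall b, b \in c.1.2 -> clause_der v cs (gmap (rval v) b)) ->
    clause_der v cs (gmap (rval v) c.1.1).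

Lemma clause_derE M (v : valuation M) cs g : clause_der v cs g ->
  exists2 c, c \in cs & world v \in c.2 /\ gmap (rval v) c.1.1 = g.
Proof. by case=> c Hc wc _; exists c. Qed.

Definition union_clauses (f : data -> data) : data -> {set clause} :=
  tfold set0 (fun a _ _ C => rule_clauses (f a) :|: C).

Lemma union_clausesP f (A : Type) (code : A -> data) s c :
  c \in union_clauses f (code_seq code s) <->
  exists2 x, List.In x s & c \in rule_clauses (f (code x)).
Proof.
elim: s => [|x s IH] /=; first by rewrite /union_clauses /= inE; split=> // -[].
rewrite /union_clauses /= inE; split.
- by case/orP=> [|/IH[y]] Hc; [exists x => //; left | exists y => //; right].
- case=> y [<-|Hy] Hc; apply/orP; first by left.
  by right; apply/IH; exists y.
Qed.

Lemma finrec_union_clauses f c : recursive f -> recursive c ->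
  finrec (fun d => union_clauses f (c d)).
Proof.
move=> Hf Hc; apply: (@finrec_tfold _ _ (fun _ a _ _ C => rule_clauses (f a) :|: C) id) => //.
  move=> x y; have r1 := rec_comp Hf (rec_comp rec_fst rec_snd).
  exact: (finrec_map (fun C => C :|: y) (finrec_comp finrec_rule_clauses r1)).
exact: rec_id.
Qed.

(** Turns the code of a fact into that of its [fact_rule]; the inner [Leaf] codes the empty body. *)
Definition fact_code (d : data) : data := Node (fstd d) (Node Leaf (sndd d)).

Lemma rec_fact_code : recursive fact_code.
Proof. exact: (rec_node rec_fst (rec_node (rec_const _) rec_snd)). Qed.

Lemma rule_subst_ground_fact σ (f : fact Sig) : ground_fact f ->
  rule_subst σ (fact_rule f) = fact_rule f.
Proof.
by case: f => A ξ [/= gA gξ]; rewrite /rule_subst /fact_rule /= asubst_ground // qsubst_ground.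
Qed.

Lemma ground_fact_rule (f : fact Sig) : ground_fact f -> ground_rule (fact_rule f).
Proof. by case. Qed.

Definition send_fact (p : term Principal) (x : term Infon) (q : term Principal) : fact Sig :=
  Fact (Msg p (t_said x) q) (QTrue Sig).

(** A step as seen by the clauses: [cs] are those of the current program without
    the messages, [cm] those of the messages sent so far. *)
Definition clause_step (cs cm cm' : {set clause}) : Prop :=
  exists p x q, [/\ tvars p = [::], tvars x = [::] & tvars q = [::]] /\
   [/\ exists M (v : valuation M), model T M /\ clause_der v (cs :|: cm) (aval v (Knows p x))
    & exists2 c, same_rule (fact_rule (send_fact p x q)) c & cm' = c |: cm].

Definition search_step (cs ch : {set clause}) (X : {set {set clause}}) : {set {set clause}} :=
  [set cm' | `[< exists2 cm, cm \in X & clause_step (cs :|: ch) cm cm' >]].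

Definition goal_reached (cs cg : {set clause}) (X : {set {set clause}}) : Prop :=
  exists2 cm, cm \in X & exists M (v : valuation M), model T M /\
    forall c, c \in cg -> world v \in c.2 -> clause_der v (cs :|: cm) (gmap (rval v) c.1.1).

Section Runs.
Variables (Po : seq (rule Sig)) (H : seq (fact Sig)).
Hypothesis T_consistent : consistent T.
Hypothesis Po_policies : policies Po.
Hypothesis H_nonmech : forall h, List.In h H -> non_mechanizable h.

Definition po_clauses : {set clause} := union_clauses id (code_seq (@code_rule Sig) Po).

Definition fact_clauses (k : nat) : {set clause} :=
  if onth H k is Some h then rule_clauses (code_rule (fact_rule h)) else set0.

(** The facts of [S] enter as bodyless clauses [cm], all other rules through [rule_clauses]. Both
    inductions exchange a ground instance with a clause of the same meaning. *)
Lemma program_der M (v : valuation M) S k (cm : {set clause}) g : model T M ->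
  (forall f, S k f -> ground_fact f) ->
  (forall c, c \in cm -> c.1.2 = set0) ->
  (forall g, holds v S k g <->
     exists2 c, c \in cm & world v \in c.2 /\ gmap (rval v) c.1.1 = g) ->
  der v (program S H Po k k) g <-> clause_der v (po_clauses :|: fact_clauses k :|: cm) g.
Proof.
move=> Mm grS body0 HS; split.
  elim=> r σ Pr gr Hc _ IH.
  have use c : c \in po_clauses :|: fact_clauses k -> same_rule (rule_subst σ r) c ->
      clause_der v (po_clauses :|: fact_clauses k :|: cm) (aval v (rhead (rule_subst σ r))).
    move=> Hcs [Rh Rb Rc]; rewrite Rh //; apply: ClauseDer.
    - by rewrite inE Hcs.
    - exact/Rc.
    - move=> b Hb.
      have /(Rb M v Mm)[A HA <-] : exists2 b', b' \in c.1.2 & gmap (rval v) b' = gmap (rval v) b.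
        by exists b.
      exact: IH.
  case: Pr => [[f [Sf Er]]|[_ [h [Eh Er]]]|[_ Hr]].
  - move: Hc; rewrite Er rule_subst_ground_fact; last exact: grS Sf.
    move=> Hc; have /HS[c Hcm [wc <-]] : holds v S k (aval v (fatom f)) by exists f.
    by apply: ClauseDer => //; [rewrite inE Hcm orbT | move=> b; rewrite body0 // inE].
  - have [c Hcr Rc] := rule_clauses_complete gr; apply: use Rc.
    by rewrite inE /fact_clauses Eh -Er Hcr orbT.
  - have [c Hcr Rc] := rule_clauses_complete gr; apply: use Rc.
    by rewrite inE; apply/orP; left; apply/union_clausesP; exists r.
elim=> c Hcs wc _ IH.
have use r σ : program S H Po k k r -> ground_rule (rule_subst σ r) ->
    same_rule (rule_subst σ r) c -> der v (program S H Po k k) (gmap (rval v) c.1.1).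
  move=> Pr gr [Rh Rb Rc]; rewrite -Rh //; apply: Der => //; first exact/Rc.
  move=> A HA.
  have /(Rb M v Mm)[b Hb <-] : exists2 A', List.In A' (rbody (rule_subst σ r))
      & aval v A' = aval v A by exists A.
  exact: IH.
move: Hcs; rewrite !inE => /orP[/orP[/union_clausesP[r Hr Hc]|Hc]|Hc].
- by have [σ gr R] := rule_clauses_sound Hc; apply: use gr R; apply: Or33.
- move: Hc; rewrite /fact_clauses; case Eh: (onth H k) => [h|]; last by rewrite inE.
  move=> Hc; have [σ gr R] := rule_clauses_sound Hc; apply: use gr R.
  by apply: Or32; split=> //; exists h.
- have /HS[f Sf [Hf <-]] : exists2 c', c' \in cm &
      world v \in c'.2 /\ gmap (rval v) c'.1.1 = gmap (rval v) c.1.1 by exists c.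
  (* The fact is ground, so the identity substitution [Var Sig] will do. *)
  have := @Der _ M v (program S H Po k k) (fact_rule f) (Var Sig).
  rewrite rule_subst_ground_fact; last exact: grS Sf.
  by apply=> //; [apply: Or31; exists f | apply: ground_fact_rule; apply: grS Sf].
Qed.

Definition kind (X : Type) (g : gatom X) : option bool := g.1.1.1.

(** Consistency supplies a model in which the kind of the head can be read off. *)
Lemma same_rule_kind r c : same_rule r c ->
  kind c.1.1 = match rhead r with Knows _ _ => Some true | Uknows _ _ => Some false | _ => None end.
Proof.
case=> R _ _; have [M Mm] := T_consistent; have [v _] := valuation_inhabited M.
by have := R M v Mm; case: (rhead r) => [p x|p x|p s q] /= [].
Qed.

(** Neither a policy nor a non-mechanizable fact has a message as its head, so messages can only
    come from [cm]. *)
Lemma fixed_clause_kind k c : c \in po_clauses :|: fact_clauses k -> kind c.1.1 <> None.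
Proof.
rewrite inE => /orP[/union_clausesP[r Hr /rule_clauses_sound[σ _ /same_rule_kind->]]|].
  case: Po_policies => _ /(_ r Hr)[->|[]] //=; by case: (rhead r).
rewrite /fact_clauses; case Eh: (onth H k) => [h|]; last by rewrite inE.
move=> /rule_clauses_sound[σ _ /same_rule_kind->].
have /H_nonmech[_] /= : List.In h H.
  elim: (H) k Eh => [|h' H' IH] [|k] //= Eh; last by right; apply: IH Eh.
  by left; case: Eh.
by case: (fatom h).
Qed.

(** Links a state of a run to a state [cm] of the automaton. The absence of facts beyond step [k]
    makes the messages of step [k.+1] exactly those that [send] adds. *)
Definition invariant k (S : state Sig) (cm : {set clause}) : Prop :=
  [/\ forall j f, k < j -> ~ S j f,
      forall j f, S j f -> ground_fact f,
      forall M (v : valuation M), model T M -> forall g,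
        holds v S k g <-> clause_der v (po_clauses :|: fact_clauses k :|: cm) g
    & forall c, c \in cm -> kind c.1.1 = None /\ c.1.2 = set0].

Lemma invariant0 : invariant 0 (lfp (program (@empty_state Sig) H Po 0)) set0.
Proof.
split; last by move=> c; rewrite inE.
- by case=> // j f _ /lfp_rule[r [[f' []]|[]|[]]].
- by move=> j f; apply: lfp_ground.
- move=> M v Mm g; rewrite lfp_holds; apply: program_der => //.
    by move=> c; rewrite inE.
  by move=> g'; split=> -[c] //; rewrite inE.
Qed.

(** An old message can be derived at step [k] only by a clause of [cm], by [fixed_clause_kind];
    conversely the clauses of [cm] have no body, so they fire wherever their constraint holds. *)
Lemma invariantS k S cm p x q c :
  tvars p = [::] -> tvars x = [::] -> tvars q = [::] ->
  same_rule (fact_rule (send_fact p x q)) c -> invariant k S cm ->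
  invariant k.+1 (lfp (program (send S k p x q) H Po k.+1)) (c |: cm).
Proof.
move=> gp gx gq Rc [empty gr sem msg].
have msg' c' : c' \in c |: cm -> kind c'.1.1 = None /\ c'.1.2 = set0.
  rewrite !inE => /orP[/eqP->|/msg] //; split; first by rewrite (same_rule_kind Rc).
  (* An atom in the body of [c] would have to match, in some model, an element of the empty body of
     the sent fact. *)
  case: Rc => _ R _; apply/eqP; rewrite -subset0; apply/subsetP => b Hb.
  have [M Mm] := T_consistent; have [v _] := valuation_inhabited M.
  by have /(R M v Mm)[A []] : exists2 b', b' \in c.1.2 & gmap (rval v) b' = gmap (rval v) b
    by exists b.
split=> // [j f Hj /lfp_rule[r [[f' [[Sf|[Ej _]] _]]|[Ej _]|[Ej _]]]|j f|M v Mm g].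
- exact: (empty j f' (ltnW Hj)).
- by rewrite Ej ltnn in Hj.
- by rewrite Ej ltnn in Hj.
- by rewrite Ej ltnn in Hj.
- exact: lfp_ground.
rewrite lfp_holds; apply: program_der => // [f|c' /msg'[]|{}g] //.
  case=> [/gr//|[_ [[_ /gr//]|->]]]; split=> //=.
  by rewrite gp gx gq.
have [Rh _ Rt] := Rc; split.
- case=> f [Hf|[_ [[Km Sf]|->]]] [tf <-].
  + by case: (empty k.+1 f).
  + have /sem/clause_derE[//|c' Hc' [wc' Eg]] : holds v S k (aval v (fatom f)) by exists f.
    exists c'; last by split.
    move: Hc'; rewrite in_setU => /orP[/fixed_clause_kind[]|Hc']; last by rewrite setU1r.
    by rewrite -[kind _]/(kind (gmap (rval v) c'.1.1)) Eg; case: (fatom f) Km.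
  + exists c; first exact: setU11.
    by split; [apply/Rt | rewrite -Rh].
- case=> c'; rewrite !inE => /orP[/eqP->|Hc'] [wc' <-].
    by exists (send_fact p x q); [right; split=> //; right | rewrite -Rh].
  have [Kc' Bc'] := msg _ Hc'.
  have /sem[//|f Sf [tf Ef]] : clause_der v (po_clauses :|: fact_clauses k :|: cm)
      (gmap (rval v) c'.1.1).
    by apply: ClauseDer => //; [rewrite inE Hc' orbT | rewrite Bc' => b; rewrite inE].
  exists f => //; right; split=> //; left; split=> //.
  by move: Kc'; rewrite -[kind _]/(kind (gmap (rval v) c'.1.1)) -Ef; case: (fatom f).
Qed.

Lemma invariant_satisfiable k S cm (G : seq (fact Sig)) : invariant k S cm ->
  (forall g, List.In g G -> ground_fact g) ->
  state_satisfiable T S k G <->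
  exists M (v : valuation M), model T M /\ forall g, List.In g G ->
    qtrue v (fconstr g) ->
    clause_der v (po_clauses :|: fact_clauses k :|: cm) (aval v (fatom g)).
Proof.
move=> [_ gr sem _] grG; rewrite state_satisfiableP //.
by split=> -[M [v [Mm HG]]]; exists M, v; split=> // g Hg Hc; apply/sem => //; apply: HG.
Qed.

(** The sent fact is ground, so [rule_clauses_complete] supplies the clause to add. *)
Lemma step_clauses k S S' cm : invariant k S cm -> step T k S S' ->
  exists2 cm', clause_step (po_clauses :|: fact_clauses k) cm cm' &
    invariant k.+1 (lfp (program S' H Po k.+1)) cm'.
Proof.
move=> inv [p x q gp gx gq].
rewrite (invariant_satisfiable inv); last by move=> g [<-|//]; split; rewrite //= gp gx.
case=> M [v [Mm HG]].
have gs : ground_fact (send_fact p x q) by split; rewrite //= gp gx gq.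
have [c _] : exists2 c, c \in rule_clauses (code_rule (fact_rule (send_fact p x q)))
    & same_rule (rule_subst (Var Sig) (fact_rule (send_fact p x q))) c.
  by apply: rule_clauses_complete; rewrite rule_subst_ground_fact //; apply: ground_fact_rule.
rewrite rule_subst_ground_fact // => Rc.
exists (c |: cm); last exact: invariantS.
exists p, x, q; split=> //; split; last by exists c.
by exists M, v; split=> //; apply: (HG (Fact (Knows p x) (QTrue Sig))) => //; left.
Qed.

(** Conversely, the ground terms recorded in [clause_step] make up a step of the run. *)
Lemma clause_step_step k S cm cm' : invariant k S cm ->
  clause_step (po_clauses :|: fact_clauses k) cm cm' ->
  exists2 S', step T k S S' & invariant k.+1 (lfp (program S' H Po k.+1)) cm'.
Proof.
move=> inv [p [x [q [[gp gx gq] [[M [v [Mm HM]]] [c Rc ->]]]]]].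
exists (send S k p x q); last exact: invariantS.
apply: Step => //; rewrite (invariant_satisfiable inv).
  by exists M, v; split=> // g [<-|//].
by move=> g [<-|//]; split; rewrite //= gp gx.
Qed.

(** * The automaton of message sets *)

Definition reached (k : nat) : {set {set clause}} :=
  foldl (fun X h => search_step po_clauses (rule_clauses (code_rule (fact_rule h))) X)
    [set set0] (take k H).

Lemma reachedS k : k < size H ->
  reached k.+1 = search_step po_clauses (fact_clauses k) (reached k).
Proof.
rewrite /reached /fact_clauses; elim: (H) k [set set0] => //= h s IH [|k] X Hk /=.
  by rewrite take0.
by rewrite IH.
Qed.

Lemma run_reached k S : k <= size H -> run T Po H k S ->
  exists2 cm, cm \in reached k & invariant k S cm.
Proof.
move=> Hk run; elim: run Hk => [_|{}k {}S S' _ IH HS Hk].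
  by exists set0; [rewrite /reached take0 inE | exact: invariant0].
have [cm Hcm inv] := IH (ltnW Hk); have [cm' Hcm' inv'] := step_clauses inv HS.
by exists cm' => //; rewrite reachedS // inE; apply/asboolP; exists cm.
Qed.

Lemma reached_run k cm : k <= size H -> cm \in reached k ->
  exists2 S, run T Po H k S & invariant k S cm.
Proof.
elim: k cm => [|k IH] cm Hk.
  rewrite /reached take0 inE => /eqP->; eexists; [exact: Run0 | exact: invariant0].
rewrite reachedS // inE => /asboolP[cm0 /(IH _ (ltnW Hk))[S HS inv] Hcm].
have [S' HS' inv'] := clause_step_step inv Hcm.
by eexists; [exact: RunS HS HS' | exact: inv'].
Qed.

Lemma bounded_reachabilityP (G : seq (fact Sig)) : query G ->
  bounded_reachability T (Instance Po H G) <->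
  goal_reached po_clauses (union_clauses fact_code (code_seq (@code_fact Sig) G))
    (reached (size H)).
Proof.
move=> HG; have grG g : List.In g G -> ground_fact g by case/HG.
(* No fact has index [size H]: the last program consists of policies and messages. *)
have none : fact_clauses (size H) = set0.
  by rewrite /fact_clauses; elim: (H).
(* Each query fact is ground, so all its clauses have the same meaning as the fact itself. *)
have goalP M (v : valuation M) cm : model T M ->
    (forall g, List.In g G -> qtrue v (fconstr g) ->
      clause_der v (po_clauses :|: cm) (aval v (fatom g))) <->
    (forall c, c \in union_clauses fact_code (code_seq (@code_fact Sig) G) ->
      world v \in c.2 -> clause_der v (po_clauses :|: cm) (gmap (rval v) c.1.1)).
  move=> Mm; split=> [D c /union_clausesP[g Hg Hc] wc|D g Hg Hc].
    have [σ _] := rule_clauses_sound (r := fact_rule g) Hc.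
    rewrite rule_subst_ground_fact; last exact: grG.
    by case=> Rh _ Rt; rewrite -Rh //; apply: D => //; apply/Rt.
  have [c Hcg] : exists2 c, c \in rule_clauses (code_rule (fact_rule g))
      & same_rule (rule_subst (Var Sig) (fact_rule g)) c.
    apply: rule_clauses_complete; rewrite rule_subst_ground_fact; last exact: grG.
    exact/ground_fact_rule/grG.
  rewrite rule_subst_ground_fact; last exact: grG.
  case=> Rh _ Rt; rewrite [aval _ _]Rh //; apply: D; last exact/Rt.
  by apply/union_clausesP; exists g.
split.
- case=> S [/run_reached-/(_ (leqnn _))[cm Hcm inv]].
  move=> /(invariant_satisfiable inv grG)[M [v [Mm HM]]].
  rewrite none setU0 in HM; exists cm => //; exists M, v; split=> //.
  exact/goalP.
- case=> cm /(reached_run (leqnn _))[S HS inv] [M [v [Mm HM]]]; exists S; split=> //.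
  apply/(invariant_satisfiable inv grG); rewrite none setU0.
  by exists M, v; split=> //; apply/goalP.
Qed.
End Runs.

(** * The decision procedure *)

Local Notation transformer :=
  {ffun {set clause} * {set {set clause}} -> {set {set clause}}}.

(** The fold evaluates the tail first while the automaton reads from the front. Its value is
    therefore a function on sets of states, which applies the transition of the head before those of
    the tail. *)
Definition search (d : data) : transformer :=
  tfold [ffun u => u.2]
    (fun a _ _ f => [ffun u => f (u.1, search_step u.1 (rule_clauses (fact_code a)) u.2)]) d.

Lemma search_code Po H : search (code_seq (@code_fact Sig) H) (po_clauses Po, [set set0]) =
  reached Po H (size H).
Proof.
rewrite /reached take_size; elim: H [set set0] => [|h H IH] X; rewrite /search /= ffunE //.
Qed.

Definition decide (d : data) : bool :=
  let cs := union_clauses id (fstd d) in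
  `[< goal_reached cs (union_clauses fact_code (sndd (sndd d)))
        (search (fstd (sndd d)) (cs, [set set0])) >].

(** [goal_reached] and [search_step] are defined classically, but their arguments range over finite
    types, so [finrec_map] and [finrec_map2] apply. *)
Lemma finrec_decide : finrec decide.
Proof.
have H1 := finrec_union_clauses rec_id rec_fst.
have H2 := finrec_union_clauses rec_fact_code (rec_comp rec_snd rec_snd).
have H3 : finrec (fun d => search (fstd (sndd d))).
  apply: (@finrec_tfold _ _ (fun _ a _ _ (f : transformer) =>
    [ffun u => f (u.1, search_step u.1 (rule_clauses (fact_code a)) u.2)]) id).
  - move=> x y.
    have r := rec_comp rec_fact_code (rec_comp rec_fst rec_snd).
    exact: (finrec_map (fun C => [ffun u => y (u.1, search_step u.1 C u.2)])
      (finrec_comp finrec_rule_clauses r)).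
  - exact: rec_id.
  - exact: (rec_comp rec_fst rec_snd).
have H23 := finrec_map2 (@pair _ _) H2 H3.
have H := finrec_map2
  (fun (cs : {set clause}) (gf : {set clause} * transformer) =>
     `[< goal_reached cs gf.1 (gf.2 (cs, [set set0])) >]) H1 H23.
by apply: finrec_ext H.
Qed.

Lemma bounded_reachability_decidable : consistent T ->
  decidable_on (@code_instance Sig) (@well_formed Sig) (bounded_reachability T).
Proof.
move=> Tc; exists (fun d => if decide d then Node Leaf Leaf else Leaf); split.
  apply: (rec_fin_case (h := fun b _ => if b then Node Leaf Leaf else Leaf) finrec_decide).
  by move=> b; apply: rec_const.
case=> Po H G [/= HPo _ HH HG]; rewrite bounded_reachabilityP //.
rewrite /decide /= -search_code -/(po_clauses Po).
by case: asboolP => H'; split.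
Qed.
End Representatives.

Theorem theorem1 (Sig : signature) (T : theory Sig) (C : seq (term Sig Principal)) :
  substrate_theory T ->
  finite_principals T C ->
  closed_under_substructures T ->
  effectively_locally_finite T ->
  ground_satisfiability_decidable T ->
  decidable_on (@code_instance Sig)
    (fun I => well_formed I /\ local_vars_principals (pol I))
    (bounded_reachability T).
Proof.
move=> [Tc _] _ _ [reps [R [N [_ _ _ ground repr]]]] _.
(* With no fresh constants, the representatives [reps [::]] are ground terms. The default [t0] is
   never returned, as indices stay below the size. *)
pose t0 : sterm Sig := Tagged (term Sig) (Var Sig Principal 0).
pose gt (i : 'I_(size (reps [::]))) := nth t0 (reps [::]) i.
have gt_in i : List.In (gt i) (reps [::]).
  rewrite /gt; elim: (reps [::]) (nat_of_ord i) (ltn_ord i) => //= t s IH [|n] Hn; first by left.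
  by right; apply: IH.
have gt_ground i : tvars (tagged (gt i)) = [::].
  have := ground _ _ (gt_in i); rewrite /term_over.
  by case: (tvars _) => // x s /(_ x); rewrite mem_head => /(_ isT).
have gt_repr s (u : term Sig s) : tvars u = [::] -> exists i, tag (gt i) = s /\ rep T gt u i.
  move=> gu; have [|t [Ht Et _]] := repr [::] s u; first by rewrite /term_over /= gu.
  have [i Ei] : exists i, gt i = Tagged (term Sig) t.
    have [n Hn En] : exists2 n, n < size (reps [::]) & nth t0 (reps [::]) n = Tagged (term Sig) t.
      elim: (reps [::]) Ht => //= x r IH [->|/IH[n Hn En]]; first by exists 0.
      by exists n.+1.
    by exists (Ordinal Hn).
  exists i; rewrite /rep /rval Ei; split=> // M v Mm.
  by rewrite /tval (Et M Mm v).
have [F [RF HF]] := bounded_reachability_decidable gt_ground gt_repr Tc.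
by exists F; split=> // I [wf _]; apply: HF.
Qed.
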